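(* Let $\alpha=\{a_j\}_{j=1}^\infty$ be a sequence of strictly positive real numbers, let $m$ be a positive integer, and suppose $L_1(\alpha;m)<\infty$. For each $N$ let $T_m(N)$ be the coupon-collector variable associated with the coupon probabilities $p_j=a_j/A_N$, $1\le j\le N$, where $A_N=\sum_{j=1}^N a_j$. Set $$\delta_N:=L_1(\alpha;m)-E_m(N;\alpha),\qquad \Delta_N:=L_2(\alpha;m)-Q_m(N;\alpha).$$ Then $\delta_N=o(1)$ and $\Delta_N=o(1)$ as $N\to\infty$, and $$E[T_m(N)]=A_N\big(L_1(\alpha;m)-\delta_N\big)=A_N L_1(\alpha;m)\,(1+o(1)),$$ $$E[T_m(N)(T_m(N)+1)]=A_N^2\big(L_2(\alpha;m)-\Delta_N\big)=A_N^2L_2(\alpha;m)\,(1+o(1)),$$ $$V[T_m(N)]=A_N^2\left[L_2(\alpha;m)-L_1(\alpha;m)^2\right]\left[1+o(1)\right]$$ as $N\to\infty$. Furthermore, it is always true that $L_2(\alpha;m)-L_1(\alpha;m)^2>0$.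
   Context: Coupon collector setting: coupons of $N$ types are drawn independently with replacement, type $j$ having probability $p_j>0$, $\sum_{j=1}^Np_j=1$. $T_m(N)$ is the number of draws needed until every one of the $N$ types has been drawn at least $m$ times. $E$ and $V$ denote expectation and variance. $S_m(y)=\sum_{l=0}^{m-1}\frac{y^l}{l!}$. For a sequence $\alpha=\{a_j\}$ of strictly positive numbers, $$E_m(N;\alpha)=\int_0^\infty\Big[1-\prod_{j=1}^N\big(1-e^{-a_jt}S_m(a_jt)\big)\Big]dt,\qquad Q_m(N;\alpha)=2\int_0^\infty t\Big[1-\prod_{j=1}^N\big(1-e^{-a_jt}S_m(a_jt)\big)\Big]dt,$$ $$L_1(\alpha;m)=\lim_{N}E_m(N;\alpha)=\int_0^1\Big\{1-\prod_{j=1}^\infty\big[1-x^{a_j}S_m(-a_j\ln x)\big]\Big\}\frac{dx}{x},$$ $$L_2(\alpha;m)=\lim_{N}Q_m(N;\alpha)=-2\int_0^1\Big\{1-\prod_{j=1}^\infty\big[1-x^{a_j}S_m(-a_j\ln x)\big]\Big\}\frac{\ln x}{x}\,dx.$$ (These limits exist in $(0,\infty]$ by monotone convergence; $L_1(\alpha;m)<\infty$ if and only if $L_2(\alpha;m)<\infty$.) *)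

(* Defs.v *)
From HB Require Import structures.
From mathcomp Require Import all_boot all_order all_algebra.
From mathcomp Require Import all_classical all_reals all_analysis.
Set Implicit Arguments.
Unset Strict Implicit.
Unset Printing Implicit Defensive.
Import Order.TTheory GRing.Theory Num.Theory.
Import numFieldNormedType.Exports.
Local Open Scope classical_set_scope.
Local Open Scope ring_scope.
Local Open Scope ereal_scope.

(* Sequences are 0-based: [a j] stands for a_{j+1}, and the coupon types of the
   N-th experiment are the labels j < N. *)

Definition partial_weight (R : realType) (a : nat -> R) (N : nat) : R :=
  (\sum_(j < N) a j)%R.

Definition exp_trunc (R : realType) (m : nat) (y : R) : R :=
  (\sum_(l < m) y ^+ l / l`!%:R)%R.

Definition E_m (R : realType) (m : nat) (a : nat -> R) (N : nat) : \bar R :=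
  \int[lebesgue_measure]_(t in `[0%R, +oo[)
    (1 - \prod_(j < N) (1 - expR (- (a j * t)) * exp_trunc m (a j * t)))%:E.

Definition Q_m (R : realType) (m : nat) (a : nat -> R) (N : nat) : \bar R :=
  2%:E * \int[lebesgue_measure]_(t in `[0%R, +oo[)
    (t * (1 - \prod_(j < N)
                (1 - expR (- (a j * t)) * exp_trunc m (a j * t))))%:E.

(* For 0 < x < 1 the factors lie in ]0, 1[, so the partial products decrease
   and the limit defining the infinite product exists. *)
Definition inf_prod (R : realType) (m : nat) (a : nat -> R) (x : R) : R :=
  limn (fun n => \prod_(j < n)
          (1 - x `^ (a j) * exp_trunc m (- a j * ln x)))%R.

(* L1 and L2 are the integrals over ]0, 1[, possibly +oo; that they are the
   limits of [E_m m a N] and [Q_m m a N] is not built into the definitions. *)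
Definition L1 (R : realType) (m : nat) (a : nat -> R) : \bar R :=
  \int[lebesgue_measure]_(x in `]0%R, 1%R[) ((1 - inf_prod m a x) / x)%:E.

Definition L2 (R : realType) (m : nat) (a : nat -> R) : \bar R :=
  - 2%:E * \int[lebesgue_measure]_(x in `]0%R, 1%R[)
             ((1 - inf_prod m a x) * (ln x / x))%:E.

Section coupon_collector.
Context d (Omega : measurableType d) (R : realType) (P : probability Omega R).

Definition mutually_independent (X : nat -> {RV P >-> nat}) : Prop :=
  forall (s : seq nat) (B : nat -> set nat), uniq s ->
    P (\big[setI/setT]_(k <- s) (X k @^-1` B k)) =
    \prod_(k <- s) P (X k @^-1` B k).

(* [X k] is the label of the (k+1)-st draw. Labels are taken in nat rather than
   'I_N so that N = 0 needs no special treatment; since the p_j with j < N sum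
   to 1, the other labels have probability 0. *)
Definition coupon_draws (N : nat) (p : nat -> R)
    (X : nat -> {RV P >-> nat}) : Prop :=
  mutually_independent X /\
  forall k j, (j < N)%N -> P (X k @^-1` [set j]) = (p j)%:E.

Definition collected (N m : nat) (X : nat -> {RV P >-> nat}) (n : nat)
    (w : Omega) : Prop :=
  forall j, (j < N)%N -> (m <= \sum_(k < n) (X k w == j))%N.

(* The infimum is +oo when the collection is never completed; this happens with
   probability 0, and [fine] then returns 0. *)
Definition collect_time (N m : nat) (X : nat -> {RV P >-> nat})
    (w : Omega) : R :=
  fine (ereal_inf [set n%:R%:E | n in [set n : nat | collected N m X n w]]).

End coupon_collector.

(* f_N = g_N (1 + o(1)) as N tends to infinity *)
Definition eq_mul_1o (R : realType) (f g : nat -> \bar R) : Prop :=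
  exists e : nat -> R, e @ \oo --> (0 : R)%R /\
    \forall N \near \oo, f N = g N * (1 + e N)%:E.

(* Main.v *)
(* Poissonization. The probability D(n) that the collection is incomplete after n
   draws satisfies a first-step recursion on the missing coupons, and comparing
   derivatives in z shows that
     1 - prod_j (1 - e^(-p_j z) S_m(p_j z)) = sum_n D(n) e^(-z) z^n / n!.
   Integrating against dz and z dz, with z = A_N t, gives A_N E_m(N) = sum_n D(n) =
   E[T] and A_N^2 Q_m(N) = sum_n 2(n+1) D(n) = E[T(T+1)].

   The substitution x = e^(-t) and monotone convergence give E_m(N) -> L_1 and
   Q_m(N) -> L_2. If L_1 is finite, Markov's inequality bounds
   sum_j e^(-a_j t) S_m(a_j t) at some t = t_0; hence a_j is bounded away from 0,
   so that A_N -> +oo and the integrands of Q_m(N) decay exponentially, uniformly in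
   N, whence L_2 is finite. Finally Q_m(N) - E_m(N)^2 is twice the integral of a
   nonnegative function that dominates a fixed one of positive integral. *)
Require Import Defs.
From HB Require Import structures.
From mathcomp Require Import all_boot all_order all_algebra.
From mathcomp Require Import all_classical all_reals all_analysis.
From mathcomp Require Import measurable_realfun ring lra.
Set Implicit Arguments.
Unset Strict Implicit.
Unset Printing Implicit Defensive.
Import Order.TTheory GRing.Theory Num.Theory.
Import numFieldNormedType.Exports.
Local Open Scope classical_set_scope.
Local Open Scope ring_scope.

(** * Remainders of the exponential series *)

Section exp_remainder.
Context {R : realType}.
Implicit Types (n : nat) (y z : R).

(** For y >= 0, e^(-y) [exp_rem n y] is the probability that a Poisson variable of mean y is at
    least [n]. *)
Definition exp_rem n y := expR y - exp_trunc n y.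

Lemma exp_trunc0 y : exp_trunc 0 y = 0.
Proof. by rewrite /exp_trunc big_ord0. Qed.

Lemma exp_truncS n y : exp_trunc n.+1 y = exp_trunc n y + y ^+ n / n`!%:R.
Proof. by rewrite /exp_trunc big_ord_recr. Qed.

Lemma exp_trunc_at0 n : exp_trunc n (0 : R) = (n != 0)%:R.
Proof.
elim: n => [|n IH]; first by rewrite exp_trunc0.
rewrite exp_truncS IH; case: n {IH} => [|n]; first by rewrite expr0 add0r divr1.
by rewrite exprS mul0r mul0r addr0.
Qed.

Lemma is_derive_exp_term n y :
  is_derive y 1 (fun z => z ^+ n / n`!%:R) (y ^+ n.-1 / n.-1`!%:R *+ (n != 0)).
Proof.
case: n => [|n] /=.
  rewrite (_ : (fun z : R => _) = cst (1 : R)); first exact: is_derive_cst.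
  by apply/funext => z /=; rewrite expr0 divr1.
rewrite (_ : (fun z : R => _) = (n.+1`!%:R^-1 : R) *: (fun z : R => z ^+ n.+1)); last first.
  by apply/funext => z; rewrite fctE /= mulrC.
rewrite (_ : (fun z : R => z ^+ n.+1) = (id : R -> R) ^+ n.+1); last first.
  by apply/funext => z; rewrite fctE.
apply: is_derive_eq; rewrite factS natrM /GRing.scale /= !mulr1.
by rewrite mulr1n mulrA invfM [_ * n.+1%:R]mulrAC mulVf ?mul1r 1?mulrC// pnatr_eq0.
Qed.

Lemma is_derive_exp_trunc n y :
  is_derive y 1 (exp_trunc n.+1) (exp_trunc n y).
Proof.
elim: n => [|n IH].
  rewrite exp_trunc0 (_ : exp_trunc 1 = cst 1); first exact: is_derive_cst.
  by apply/funext => z; rewrite exp_truncS exp_trunc0 add0r expr0 divr1.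
rewrite (_ : exp_trunc n.+2 = exp_trunc n.+1 + (fun z => z ^+ n.+1 / n.+1`!%:R)).
  by rewrite exp_truncS; apply: is_deriveD; exact: is_derive_exp_term.
by apply/funext => z; rewrite fctE exp_truncS.
Qed.

(** The truncated predecessor also covers [n = 0], where [exp_rem 0] is the exponential itself.
    Lowering the index by one mirrors the effect of a draw on a requirement. *)
Lemma is_derive_exp_rem n y : is_derive y 1 (exp_rem n) (exp_rem n.-1 y).
Proof.
case: n => [|n] /=.
  rewrite (_ : exp_rem 0 = expR); last first.
    by apply/funext => z; rewrite /exp_rem exp_trunc0 subr0.
  exact: is_derive_expR.
by apply: is_deriveB; exact: is_derive_exp_trunc.
Qed.

Lemma exp_trunc_ge0 n y : 0 <= y -> 0 <= exp_trunc n y.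
Proof.
by move=> y0; apply: sumr_ge0 => i _; rewrite divr_ge0 ?exprn_ge0.
Qed.

Lemma exp_rem_le n y : 0 <= y -> exp_rem n y <= expR y.
Proof. by move=> y0; rewrite gerBl exp_trunc_ge0. Qed.

Lemma ge0_derive_ge0 (f df : R -> R) : (forall y, is_derive y 1 f (df y)) ->
  (forall y, 0 <= y -> 0 <= df y) -> 0 <= f 0 -> forall y, 0 <= y -> 0 <= f y.
Proof.
move=> fdf df0 f0 y y0; apply: (le_trans f0).
apply: (@ger0_derive1_ndecr _ f 0 y) => //.
- move=> x /[!in_itv]/= /andP[/ltW x0 _].
  by rewrite derive1E; have [_ ->] := fdf x; exact: df0.
- by apply: derivable_within_continuous => x _; have [] := fdf x.
Qed.

(** By induction: at rank [n.+1] the remainder vanishes at 0 and its derivative is the remainder of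
    rank [n]. *)
Lemma exp_rem_ge0 n y : 0 <= y -> 0 <= exp_rem n y.
Proof.
elim: n y => [|n IH] y y0.
  by rewrite /exp_rem exp_trunc0 subr0 expR_ge0.
apply: (ge0_derive_ge0 (is_derive_exp_rem n.+1)) => //.
by rewrite /exp_rem expR0 exp_trunc_at0 subrr.
Qed.

Lemma exp_rem_cvg0 y : (fun n => exp_rem n y) @ \oo --> (0 : R).
Proof.
rewrite -(subrr (expR y)); apply: cvgB; first exact: cvg_cst.
have := is_cvg_series_exp_coeff y.
rewrite (_ : (fun n => exp_trunc n y) = series (exp_coeff y)) //.
by apply/funext => n; rewrite /exp_trunc /series /= big_mkord.
Qed.

End exp_remainder.

(** * Poissonization of the incompleteness probabilities *)

Section poissonization.
Context {R : realType}.
Variables (N : nat) (p : nat -> R).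
Implicit Types (r : nat -> nat) (n : nat) (z : R).

(* A requirement [r : nat -> nat] asks for at least [r j] coupons of each type
   [j < N]; [draw r i] is what remains of it after a coupon of type [i], and
   [pending n r] is the probability that it is unmet after [n] draws. *)
Definition draw r i : nat -> nat := fun j => if j == i then (r j).-1 else r j.

Fixpoint pending n r : R :=
  if n is n'.+1 then \sum_(i < N) p i * pending n' (draw r i)
  else (~~ [forall j : 'I_N, r j == 0%N])%:R.

(** When the p_j sum to 1, e^(-z) [rem_prod N r z] is the probability that independent Poisson
    counts of means p_j z meet [r]. The number [M] of factors is kept apart from [N] to allow
    induction on it. *)
Definition rem_prod M r z := \prod_(j < M) exp_rem (r j) (p j * z).

Lemma rem_prod_eq M r r' z : (forall j, (j < M)%N -> r j = r' j) ->
  rem_prod M r z = rem_prod M r' z.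
Proof. by move=> rr'; apply: eq_bigr => j _; rewrite rr'. Qed.

(** In the product rule, differentiating factor [i] brings out p_i and lowers [r i] by one, that is,
    replaces [r] by [draw r i]. This is the same recursion as for [pending]. *)
Lemma is_derive_rem_prod M r z :
  is_derive z 1 (rem_prod M r) (\sum_(i < M) p i * rem_prod M (draw r i) z).
Proof.
elim: M => [|M IH].
  rewrite big_ord0 (_ : rem_prod 0 r = cst 1); first exact: is_derive_cst.
  by apply/funext => x; rewrite /rem_prod big_ord0.
have S q x : rem_prod M.+1 q x = rem_prod M q x * exp_rem (q M) (p M * x).
  by rewrite /rem_prod big_ord_recr.
have dM : is_derive z 1 (fun x => exp_rem (r M) (p M * x))
    (p M * exp_rem (r M).-1 (p M * z)).
  have dl : is_derive z 1 (fun x : R => p M * x) (p M).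
    have := @is_deriveZ _ _ _ (@id R) (p M) z 1 1 (is_derive_id _ _).
    by rewrite /GRing.scale /= mulr1.
  have := is_derive_exp_rem (r M) (p M * z).
  by move=> de; have := @is_derive1_comp _ _ _ _ _ _ de dl; rewrite mulrC.
rewrite (_ : rem_prod M.+1 r = rem_prod M r * (fun x => exp_rem (r M) (p M * x))); last first.
  by apply/funext => x; rewrite S fctE.
apply: is_derive_eq; rewrite /GRing.scale /= big_ord_recr /=.
rewrite addrC; congr (_ + _).
  rewrite S mulrCA; congr (_ * (_ * _)); last by rewrite /draw eqxx.
  by apply: rem_prod_eq => j jM; rewrite /draw (ltn_eqF jM).
rewrite mulr_sumr; apply: eq_bigr => i _.
by rewrite S /draw (gtn_eqF (ltn_ord i)); ring.
Qed.

Lemma rem_prod_at0 r : rem_prod N r 0 = [forall j : 'I_N, r j == 0%N]%:R.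
Proof.
have E n : exp_rem n (0 : R) = (n == 0%N)%:R.
  by rewrite /exp_rem exp_trunc_at0 expR0; case: n => [|n]; rewrite ?subr0 ?subrr.
case: forallP => [r0|/forallP].
  by rewrite /rem_prod big1 // => j _; rewrite mulr0 E r0.
rewrite negb_forall => /existsP[j rj]; rewrite /rem_prod (bigD1 j) //= mulr0 E.
by rewrite (negbTE rj) mul0r.
Qed.

Hypothesis p_ge0 : forall j, 0 <= p j.
Hypothesis sum_p : \sum_(j < N) p j = 1.

Lemma pending_ge0 n r : 0 <= pending n r.
Proof.
by elim: n r => [|n IH] r /=; rewrite ?ler0n // sumr_ge0 // => i _; rewrite mulr_ge0.
Qed.

Lemma rem_prod_ge0 r z : 0 <= z -> 0 <= rem_prod N r z.
Proof.
by move=> z0; apply: prodr_ge0 => j _; rewrite exp_rem_ge0 // mulr_ge0.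
Qed.

(** Since the p_j sum to 1, e^z is the product of the e^(p_j z), which bound the factors one by
    one. *)
Lemma rem_prod_le r z : 0 <= z -> rem_prod N r z <= expR z.
Proof.
move=> z0; rewrite -[z in expR z]mul1r -sum_p mulr_suml expR_sum.
apply: ler_prod => j _; have pz : 0 <= p j * z by rewrite mulr_ge0.
by rewrite exp_rem_ge0 // exp_rem_le.
Qed.

Let series_pending n r z := \sum_(k < n) pending k r * (z ^+ k / k`!%:R).

Let is_derive_series_pending n r z :
  is_derive z 1 (series_pending n.+1 r)
    (\sum_(i < N) p i * series_pending n (draw r i) z).
Proof.
elim: n => [|n IH].
  rewrite big1 => [|i _]; last by rewrite /series_pending big_ord0 mulr0.
  rewrite (_ : series_pending 1 r = cst (pending 0 r)); first exact: is_derive_cst.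
  by apply/funext => x; rewrite /series_pending big_ord1 expr0 divr1 mulr1.
rewrite (_ : series_pending n.+2 r =
    series_pending n.+1 r + pending n.+1 r *: (fun x => x ^+ n.+1 / n.+1`!%:R)); last first.
  by apply/funext => x; rewrite fctE /series_pending big_ord_recr.
have dn := is_derive_exp_term n.+1 z.
have dz := @is_deriveZ _ _ _ _ (pending n.+1 r) _ _ _ dn.
apply: (is_derive_eq (is_deriveD IH dz)); rewrite /GRing.scale /= mulr1n mulr_suml.
rewrite -big_split; apply: eq_bigr => i _ /=.
by rewrite /series_pending big_ord_recr /=; ring.
Qed.

(* Both bounds hold at [z = 0] and the derivatives satisfy them at rank [n]. *)
Lemma rem_prod_series n r z : 0 <= z ->
  0 <= expR z - rem_prod N r z - series_pending n r z <= exp_rem n z.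
Proof.
elim: n r z => [|n IH] r z z0.
  rewrite /series_pending big_ord0 subr0 /exp_rem exp_trunc0 subr0.
  by rewrite subr_ge0 rem_prod_le // gerBl rem_prod_ge0.
pose D r z n := expR z - rem_prod N r z - series_pending n r z.
have dD (x : R) : is_derive x 1 (fun y : R => D r y n.+1) (\sum_(i < N) p i * D (draw r i) x n).
  apply: is_derive_eq (is_deriveB (is_deriveB (is_derive_expR x)
    (is_derive_rem_prod N r x)) (is_derive_series_pending n r x)) _.
  rewrite -[expR x]mul1r -{1}sum_p mulr_suml -!sumrB; apply: eq_bigr => i _.
  by rewrite /D !mulrBr.
have D0 : D r 0 n.+1 = 0.
  rewrite /D expR0 rem_prod_at0 /series_pending big_ord_recl expr0 divr1 mulr1.
  rewrite big1 => [|i _]; last by rewrite exprS mul0r mul0r mulr0.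
  by rewrite /= addr0; case: [forall _, _] => /=; ring.
apply/andP; split.
  apply: (ge0_derive_ge0 dD); rewrite ?D0 // => x x0.
  by apply: sumr_ge0 => i _; rewrite mulr_ge0 //; have /andP[] := IH (draw r i) x x0.
rewrite -subr_ge0.
apply: (@ge0_derive_ge0 _ (fun x => exp_rem n.+1 x - D r x n.+1) _
  (fun x => is_deriveB (is_derive_exp_rem n.+1 x) (dD x))) => //.
  move=> x x0 /=; rewrite subr_ge0 -[leRHS]mul1r -sum_p mulr_suml.
  apply: ler_sum => i _; rewrite ler_wpM2l //.
  by have /andP[] := IH (draw r i) x x0.
by rewrite D0 subr0 exp_rem_ge0.
Qed.

(** Multiplied by e^z, the limit becomes e^z - [rem_prod N r z], and [rem_prod_series] puts the n-th
    partial sum within [exp_rem n z] of it. *)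
Lemma poissonization r z : 0 <= z ->
  (fun n => \sum_(0 <= k < n) pending k r * (expR (- z) * (z ^+ k / k`!%:R))) @ \oo
  --> 1 - \prod_(j < N) (1 - expR (- (p j * z)) * exp_trunc (r j) (p j * z)).
Proof.
move=> z0.
have -> : 1 - \prod_(j < N) (1 - expR (- (p j * z)) * exp_trunc (r j) (p j * z)) =
    expR (- z) * (expR z - rem_prod N r z - 0).
  rewrite subr0 mulrBr mulrC expRxMexpNx_1; congr (_ - _).
  have -> : expR (- z) = \prod_(j < N) expR (- (p j * z)).
    by rewrite -expR_sum sumrN -mulr_suml sum_p mul1r.
  rewrite -big_split.
  apply: eq_bigr => j _ /=; rewrite /exp_rem mulrBr; congr (_ - _).
  by rewrite mulrC expRxMexpNx_1.
rewrite (_ : (fun n => _) = (fun n => expR (- z) *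
   (expR z - rem_prod N r z - (expR z - rem_prod N r z - series_pending n r z)))); last first.
  apply/funext => n; rewrite opprB addrCA subrr addr0 /series_pending big_mkord mulr_sumr.
  by apply: eq_bigr => k _; ring.
apply: cvgMr; apply: cvgB; first exact: cvg_cst.
apply: (@squeeze_cvgr _ _ _ _ (fun=> 0 : R) (fun n => exp_rem n z)).
- by apply: nearW => n; exact: rem_prod_series.
- exact: cvg_cst.
- exact: exp_rem_cvg0.
Qed.

End poissonization.

(** * Poisson weights and Gamma tails *)

Section gamma_tail.
Context {R : realType}.
Implicit Types (n k : nat) (y : R).

(* [pois k y] is the probability that a Poisson variable of mean [y] equals [k];
   [surv n y] is the probability that it is below [n], i.e. that a Gamma(n)
   variable exceeds [y]. *)
Definition pois k y := expR (- y) * (y ^+ k / k`!%:R).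
Definition surv n y := expR (- y) * exp_trunc n y.

Lemma pois_ge0 k y : 0 <= y -> 0 <= pois k y.
Proof. by move=> y0; rewrite mulr_ge0 ?expR_ge0 // divr_ge0 ?exprn_ge0. Qed.

Lemma survE n y : surv n y = 1 - expR (- y) * exp_rem n y.
Proof. by rewrite /surv /exp_rem mulrBr [_ * expR y]mulrC expRxMexpNx_1 opprB addrCA subrr addr0. Qed.

Lemma surv_ge0 n y : 0 <= y -> 0 <= surv n y.
Proof. by move=> y0; rewrite mulr_ge0 ?expR_ge0 ?exp_trunc_ge0. Qed.

Lemma surv_le1 n y : 0 <= y -> surv n y <= 1.
Proof. by move=> y0; rewrite survE gerBl mulr_ge0 ?expR_ge0 ?exp_rem_ge0. Qed.

Lemma surv_gt0 n y : (0 < n)%N -> 0 <= y -> 0 < surv n y.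
Proof.
case: n => // n _ y0; rewrite mulr_gt0 ?expR_gt0 //.
rewrite /exp_trunc big_ord_recl expr0 divr1 ltr_pwDl //.
by apply: sumr_ge0 => i _; rewrite divr_ge0 ?exprn_ge0.
Qed.

Lemma surv_at0 n : surv n.+1 (0 : R) = 1.
Proof. by rewrite /surv oppr0 expR0 mul1r exp_trunc_at0. Qed.

Lemma is_derive_expRN y : is_derive y 1 (fun x => expR (- x)) (- expR (- y)).
Proof.
have := @is_derive1_comp R expR -%R y _ _ (is_derive_expR _) (is_deriveNid _ _).
by rewrite mulrN1.
Qed.

(** The derivative of a truncation is the preceding truncation, so all terms cancel except the top
    one: minus the density of Gamma(n+1). *)
Lemma is_derive_surv n y : is_derive y 1 (surv n.+1) (- pois n y).
Proof.
have h := is_deriveM (is_derive_expRN y) (is_derive_exp_trunc n y).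
apply: (is_derive_eq h); rewrite /GRing.scale /= exp_truncS /pois; ring.
Qed.

Lemma surv_nincr n y z : 0 <= y -> y <= z -> surv n z <= surv n y.
Proof.
case: n => [|n] y0 yz; first by rewrite /surv !exp_trunc0 !mulr0.
apply: (@ler0_derive1_nincr _ (surv n.+1) y z) => //.
- by move=> x _; have [] := is_derive_surv n x.
- move=> x /[!in_itv]/= /andP[yx _]; rewrite derive1E.
  have [_ ->] := is_derive_surv n x; rewrite oppr_le0 pois_ge0 //.
  by rewrite (le_trans y0) // ltW.
- by apply: derivable_within_continuous => x _; have [] := is_derive_surv n x.
Qed.

Lemma continuous_pois k : continuous (pois k).
Proof.
move=> y; apply: differentiable_continuous; apply/derivable1_diffP.
by have [] := is_deriveM (is_derive_expRN y) (is_derive_exp_term k y).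
Qed.

Lemma continuous_pois_scaled n (A : R) : continuous (fun t => pois n (A * t)).
Proof.
move=> t; apply: (@continuous_comp _ _ _ (fun t => A * t) (pois n)).
  by apply: cvgMr; exact: cvg_id.
exact: continuous_pois.
Qed.

Lemma continuous_surv n : continuous (surv n).
Proof.
case: n => [|n] y.
  rewrite (_ : surv 0 = cst 0); first exact: cst_continuous.
  by apply/funext => x; rewrite /surv exp_trunc0 mulr0.
apply: differentiable_continuous; apply/derivable1_diffP.
by have [] := is_derive_surv n y.
Qed.

(** A rearrangement of y^(k+1) / (k+1)! <= e^y. *)
Lemma pois_le k y : 0 < y -> pois k y <= k.+1%:R / y.
Proof.
move=> y0; rewrite ler_pdivlMr // /pois -mulrA expRN -ler_pdivlMl ?invr_gt0 ?expR_gt0 //.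
rewrite invrK; have := @expR_ge1Dxn R y k (ltW y0).
have -> : y ^+ k / k`!%:R * y = k.+1%:R * (y ^+ k.+1 / k.+1`!%:R).
  rewrite factS natrM invfM exprS; have : k.+1%:R != 0 :> R by rewrite pnatr_eq0.
  by move: (k.+1%:R : R) ((k`!%:R)^-1 : R) => u v u0; field.
by move=> h; rewrite mulrC ler_wpM2r //; lra.
Qed.

Lemma pois_cvg0 k : pois k y @[y --> +oo] --> (0 : R).
Proof.
apply: (@squeeze_cvgr _ _ _ _ (fun=> 0 : R) (fun y => k.+1%:R / y)).
- near=> y; have y0 : 0 < y by near: y; exact: nbhs_pinfty_gt.
  by rewrite pois_ge0 ?pois_le // ltW.
- exact: cvg_cst.
- rewrite -[X in _ --> X](mulr0 k.+1%:R); apply: cvgMr.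
  by apply/(@gtr0_cvgV0 _ _ _ _ id); [near=> y; near: y; exact: nbhs_pinfty_gt|exact: cvg_id].
Unshelve. all: by end_near. Qed.

Lemma surv_cvg0 n : surv n y @[y --> +oo] --> (0 : R).
Proof.
elim: n => [|n IH].
  rewrite (_ : surv 0 = fun=> 0); first exact: cvg_cst.
  by apply/funext => y; rewrite /surv exp_trunc0 mulr0.
rewrite (_ : surv n.+1 = fun y => surv n y + pois n y); last first.
  by apply/funext => y; rewrite /surv exp_truncS mulrDr.
by rewrite -(addr0 (0 : R)); apply: cvgD => //; exact: pois_cvg0.
Qed.

Lemma continuous_measurable_EFin (f : R -> R) (D : set R) :
  continuous f -> measurable_fun D (fun x => (f x)%:E).
Proof.
move=> cf; apply/measurable_EFinP; apply: measurable_funTS.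
exact: continuous_measurable_fun.
Qed.

(** An antiderivative is -[surv k.+1 (A * t)] / A, which rises from -1/A at 0 to 0 at infinity. *)
Lemma integral_pois k (A : R) : 0 < A ->
  (\int[lebesgue_measure]_(t in `[0%R, +oo[) (pois k (A * t))%:E = A^-1%:E)%E.
Proof.
move=> A0.
have dA (t : R) : is_derive t 1 (fun t : R => A * t) A.
  have := @is_deriveZ _ _ _ (@id R) A t 1 1 (is_derive_id _ _).
  by rewrite /GRing.scale /= mulr1.
pose F t : R := - A^-1 * surv k.+1 (A * t).
have dF (t : R) : is_derive t 1 F (pois k (A * t)).
  have h := is_derive1_comp (is_derive_surv k (A * t)) (dA t).
  apply: (is_derive_eq (is_deriveZ (- A^-1) h)); rewrite /GRing.scale /= !mulNr mulrN opprK mulrC.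
  by rewrite -mulrA mulfV ?mulr1 // gt_eqF.
have cF : continuous F.
  by move=> t; apply: differentiable_continuous; apply/derivable1_diffP; have [] := dF t.
rewrite (@ge0_continuous_FTC2y _ _ F 0 0).
- by rewrite /F mulr0 surv_at0 mulr1 sub0e EFinN oppeK.
- by move=> t t0; rewrite pois_ge0 // mulr_ge0 // ltW.
- apply: continuous_subspaceT => t.
  exact: continuous_pois_scaled.
- rewrite -[X in _ --> X](mulr0 (- A^-1)); apply: cvgMr.
  apply: (@cvg_comp _ _ _ (fun t => A * t) _ _ (pinfty_nbhs R)); last exact: surv_cvg0.
  by apply: gt0_cvgMry => //; exact: cvg_id.
- by move=> t _; have [] := dF t.
- by apply: cvg_at_right_filter; exact: cF.
- by move=> t _; rewrite derive1E; have [_ ->] := dF t.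
Qed.

(** The factor t raises the index: t [pois k (A * t)] = ((k+1)/A) [pois k.+1 (A * t)], which reduces
    the claim to [integral_pois]. *)
Lemma integral_mul_pois k (A : R) : 0 < A ->
  (\int[lebesgue_measure]_(t in `[0%R, +oo[) (t * pois k (A * t))%:E =
   (k.+1%:R / A ^+ 2)%:E)%E.
Proof.
move=> A0.
under eq_integral => t _.
  have -> : t * pois k (A * t) = k.+1%:R / A * pois k.+1 (A * t).
    rewrite /pois factS natrM invfM exprS.
    have : k.+1%:R != 0 :> R by rewrite pnatr_eq0.
    have : A != 0 by rewrite gt_eqF.
    move: (k.+1%:R : R) ((k`!%:R)^-1 : R) => u v u0 A1; field; exact/andP.
  rewrite EFinM; over.
rewrite ge0_integralZl_EFin //=.
- by rewrite integral_pois // -EFinM expr2 invfM mulrA.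
- by move=> t /[!in_itv]/= /andP[t0 _]; rewrite lee_fin pois_ge0 // mulr_ge0 // ltW.
- by apply: continuous_measurable_EFin; exact: continuous_pois_scaled.
- by rewrite divr_ge0 // ltW.
Qed.

End gamma_tail.

(** * [E_m] and [Q_m] as series of incompleteness probabilities *)

Section miss.
Context {R : realType}.
Variables (m : nat) (a : nat -> R).
Implicit Types (N n : nat) (t : R).

(* [miss N t] is the probability that the maximum of independent variables
   Gamma(m) / a_j, j < N, exceeds [t]. *)
Definition miss N t := 1 - \prod_(j < N) (1 - surv m (a j * t)).

Lemma E_m_miss N :
  E_m m a N = (\int[lebesgue_measure]_(t in `[0%R, +oo[) (miss N t)%:E)%E.
Proof. by []. Qed.

Lemma Q_m_miss N :
  Q_m m a N = (2%:E * \int[lebesgue_measure]_(t in `[0%R, +oo[) (t * miss N t)%:E)%E.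
Proof. by []. Qed.

Hypothesis a_gt0 : forall j, 0 < a j.

Let p N j := a j / partial_weight a N.

Lemma partial_weight_gt0 N : (0 < N)%N -> 0 < partial_weight a N.
Proof.
case: N => // N _; rewrite /partial_weight big_ord_recr /= ltr_wpDl //.
by apply: sumr_ge0 => j _; rewrite ltW.
Qed.

Let p_ge0 N j : (0 < N)%N -> 0 <= p N j.
Proof. by move=> N0; rewrite divr_ge0 // ltW // partial_weight_gt0. Qed.

Let sum_p N : (0 < N)%N -> \sum_(j < N) p N j = 1.
Proof.
by move=> N0; rewrite -mulr_suml divff // gt_eqF // partial_weight_gt0.
Qed.

(** Poissonization at z = A_N t, where p_j z = a_j t. *)
Lemma miss_series N t : (0 < N)%N -> 0 <= t ->
  ((miss N t)%:E = \sum_(0 <= n <oo)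
    (pending N (p N) n (fun=> m) * pois n (partial_weight a N * t))%:E)%E.
Proof.
move=> N0 t0; have A0 := partial_weight_gt0 N0.
have /= h := @poissonization _ N (p N) (fun j => p_ge0 j N0) (sum_p N0) (fun=> m)
  (partial_weight a N * t) (mulr_ge0 (ltW A0) t0).
have E j : p N j * (partial_weight a N * t) = a j * t.
  by rewrite mulrA divfK // gt_eqF.
apply/esym/cvg_lim => //.
rewrite (_ : (fun n => _) = (fun n => (\sum_(0 <= k < n)
    pending N (p N) k (fun=> m) * pois k (partial_weight a N * t))%:E)); last first.
  by apply/funext => n; rewrite -sumEFin.
apply: cvg_EFin; first exact: nearW.
rewrite (_ : miss N t = 1 - \prod_(j < N) (1 - expR (- (p N j * (partial_weight a N * t))) *
    exp_trunc m (p N j * (partial_weight a N * t)))) //.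
by congr (1 - _); apply: eq_bigr => j _; rewrite E.
Qed.

(** The nonnegative series is integrated term by term; each Poisson weight contributes 1/A_N, which
    the prefactor cancels. *)
Lemma E_m_series N : (0 < N)%N ->
  ((partial_weight a N)%:E * E_m m a N =
   \sum_(0 <= n <oo) (pending N (p N) n (fun=> m))%:E)%E.
Proof.
move=> N0; have A0 := partial_weight_gt0 N0.
have ms t : t \in `[0, +oo[ -> (miss N t)%:E = (\sum_(0 <= n <oo)
    (pending N (p N) n (fun=> m) * pois n (partial_weight a N * t))%:E)%E.
  by move=> /[!in_itv]/= /andP[t0 _]; exact: miss_series.
rewrite E_m_miss; under eq_integral => t /[!inE]/= tD do rewrite (ms t tD).
rewrite integral_nneseries //=.
- rewrite -nneseriesZl //; last first.
    move=> n _; apply: integral_ge0 => t /=; rewrite in_itv /= andbT => t0.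
    by rewrite lee_fin mulr_ge0 ?pending_ge0 ?pois_ge0 ?mulr_ge0 // 1?ltW // => j; exact: p_ge0.
  apply: eq_eseriesr => n _.
  under eq_integral do rewrite EFinM.
  rewrite ge0_integralZl_EFin //=.
  + by rewrite integral_pois // -!EFinM mulrCA divff ?mulr1 // gt_eqF.
  + move=> t /[!in_itv]/= /andP[t0 _].
    by rewrite lee_fin pois_ge0 // mulr_ge0 // ltW.
  + by apply: continuous_measurable_EFin; exact: continuous_pois_scaled.
  + by apply: pending_ge0 => j; exact: p_ge0.
- move=> n; apply: continuous_measurable_EFin => t.
  by apply: cvgMr; exact: continuous_pois_scaled.
- move=> n t /[!in_itv]/= /andP[t0 _].
  by rewrite lee_fin mulr_ge0 ?pending_ge0 ?pois_ge0 ?mulr_ge0 // 1?ltW // => j; exact: p_ge0.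
Qed.

(** As for [E_m_series], except that the weight of rank n, multiplied by t, integrates to
    (n+1)/A_N^2. *)
Lemma Q_m_series N : (0 < N)%N ->
  ((partial_weight a N ^+ 2)%:E * Q_m m a N =
   \sum_(0 <= n <oo) (2 * n.+1%:R * pending N (p N) n (fun=> m))%:E)%E.
Proof.
move=> N0; have A0 := partial_weight_gt0 N0.
have D0 n : 0 <= pending N (p N) n (fun=> m) by apply: pending_ge0 => j; exact: p_ge0.
have P0 n t : 0 <= t -> 0 <= pois n (partial_weight a N * t).
  by move=> t0; rewrite pois_ge0 // mulr_ge0 // ltW.
have ms t : t \in `[0, +oo[ -> (t * miss N t)%:E = (\sum_(0 <= n <oo)
    (pending N (p N) n (fun=> m) * (t * pois n (partial_weight a N * t)))%:E)%E.
  move=> /[!in_itv]/= /andP[t0 _].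
  rewrite EFinM miss_series // -nneseriesZl; last first.
    by move=> n _; rewrite lee_fin mulr_ge0 ?P0.
  by apply: eq_eseriesr => n _; rewrite -EFinM mulrCA.
rewrite Q_m_miss; under eq_integral => t /[!inE]/= tD do rewrite (ms t tD).
rewrite integral_nneseries //=.
- rewrite muleA -EFinM -nneseriesZl //; last first.
    move=> n _; apply: integral_ge0 => t /=; rewrite in_itv /= andbT => t0.
    by rewrite lee_fin mulr_ge0 // mulr_ge0 ?P0.
  apply: eq_eseriesr => n _.
  under eq_integral do rewrite EFinM.
  rewrite ge0_integralZl_EFin //=.
  + rewrite integral_mul_pois // -!EFinM; congr (_ %:E).
    by field; rewrite gt_eqF.
  + by move=> t /[!in_itv]/= /andP[t0 _]; rewrite lee_fin mulr_ge0 ?P0.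
  + apply: continuous_measurable_EFin => t; apply: cvgM; first exact: cvg_id.
    exact: continuous_pois_scaled.
- move=> n; apply: continuous_measurable_EFin => t.
  apply: cvgMr; apply: cvgM; first exact: cvg_id.
  exact: continuous_pois_scaled.
- move=> n t /[!in_itv]/= /andP[t0 _].
  by rewrite lee_fin mulr_ge0 // mulr_ge0 ?P0.
Qed.

End miss.

(** * The substitution x = e^(-t) *)

Section exp_substitution.
Context {R : realType}.
Notation mu := (@lebesgue_measure R).

Lemma continuous_log_pullback (g : R -> R) (x : R) : continuous g -> 0 < x ->
  {for x, continuous (fun x => g (- ln x) / x)}.
Proof.
move=> cg x0; apply: cvgM; last by apply: cvgV; [rewrite gt_eqF|exact: cvg_id].
apply: (@continuous_comp _ _ _ (fun x => - ln x) g); last exact: cg.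
by apply: cvgN; exact: continuous_ln.
Qed.

Lemma measurable_log_pullback (g : R -> R) : continuous g ->
  measurable_fun `](0:R), 1[ (fun x => (g (- ln x) / x)%:E).
Proof.
move=> cg; apply/measurable_EFinP.
apply: open_continuous_measurable_fun; first exact: interval_open.
move=> x /[!inE]/= /[!in_itv]/= /andP[x0 _].
exact: continuous_log_pullback.
Qed.

(** On compact intervals this is the usual change of variables, between [0, n] and [e^(-n), 1]. Both
    sides then pass to the limit along increasing sets, the integrands being nonnegative. *)
Lemma integral_expRN_substitution (g : R -> R) : continuous g ->
  (forall t, 0 <= t -> 0 <= g t) ->
  (\int[mu]_(x in `]0%R, 1%R[) (g (- ln x) / x)%:E =
   \int[mu]_(t in `[0%R, +oo[) (g t)%:E)%E.
Proof.
move=> cg g0; pose h x := g (- ln x) / x.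
pose F (t : R) := expR (- t).
have dF (t : R) : is_derive t 1 F (- F t) by exact: is_derive_expRN.
have F'E : F^`()%classic = fun t => - F t.
  by apply/funext => t; rewrite derive1E; have [_ ->] := dF t.
have cF : continuous F.
  by move=> t; apply: differentiable_continuous; apply/derivable1_diffP; have [] := dF t.
have mh : measurable_fun `](0:R), 1[ (fun x => (h x)%:E) by exact: measurable_log_pullback.
have mh1 : measurable_fun `](0:R), 1] h.
  by apply/measurable_fun_itv_bndo_bndcP; exact/measurable_EFinP.
have F0 : F 0 = 1 by rewrite /F oppr0 expR0.
have step n : (\int[mu]_(x in `[F n%:R, F 0%R]) (h x)%:E = \int[mu]_(t in `[0%R, n%:R]) (g t)%:E)%E.
  rewrite (@integration_by_substitution_decreasing _ F h 0 n%:R) //.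
  - apply: eq_integral => t _; rewrite F'E !fctE opprK /h /F expRK opprK.
    by rewrite divfK // gt_eqF // expR_gt0.
  - by move=> x y _ _ xy; rewrite /F ltr_expR ltrN2.
  - by move=> t _; rewrite F'E; apply: cvgN; exact: cF.
  - by rewrite F'E; apply/cvg_ex; exists (- F 0); apply: cvg_at_right_filter; apply: cvgN; exact: cF.
  - by rewrite F'E; apply/cvg_ex; exists (- F n%:R); apply: cvg_at_left_filter; apply: cvgN; exact: cF.
  - split; [by move=> t _; have [] := dF t|by apply: cvg_at_right_filter; exact: cF|].
    by apply: cvg_at_left_filter; exact: cF.
  - apply: continuous_in_subspaceT => x /[!inE]/= /[!in_itv]/= /andP[Fx _].
    by apply: continuous_log_pullback => //; apply: lt_le_trans Fx; exact: expR_gt0.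
have {F0} {}step := fun n => eq_trans (congr1 (fun u => (\int[mu]_(x in `[F n%:R, u]) (h x)%:E)%E) (esym F0)) (step n).
have cvgL : (\int[mu]_(x in `[F n%:R, 1%R]) (h x)%:E @[n --> \oo] -->
    \int[mu]_(x in `]0%R, 1%R[) (h x)%:E)%E.
  (* Adding the endpoint 1 does not change the integral, and ]0, 1] is the union of the [e^(-n), 1]:
     a point x lies in the one whose n bounds -ln x. *)
  have -> : (\int[mu]_(x in `]0%R, 1%R[) (h x)%:E = \int[mu]_(x in \bigcup_n `[F n%:R, 1%R]%classic) (h x)%:E)%E.
    rewrite integral_itv_bndo_bndc //; congr (integral _ _ _).
    apply/seteqP; split => x /=.
      rewrite in_itv /= => /andP[x0 x1]; exists (Num.bound (- ln x)) => //=.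
      rewrite in_itv /= x1 andbT -[leRHS]lnK // ler_expR lerNl ltW //.
      by rewrite archi_boundP // oppr_ge0 ln_le0.
    move=> [n _ /=]; rewrite !in_itv /= => /andP[Fx ->]; rewrite andbT.
    by apply: lt_le_trans Fx; exact: expR_gt0.
  have sub n : `[F n%:R, 1%R]%classic `<=` `]0%R, 1%R]%classic.
    move=> x /=; rewrite !in_itv /= => /andP[Fx ->]; rewrite andbT.
    by apply: lt_le_trans Fx; exact: expR_gt0.
  apply: ge0_nondecreasing_set_cvg_integral => //.
  - move=> i j ij; apply/subsetPset => x /=; rewrite !in_itv /= => /andP[Fx ->].
    by rewrite andbT (le_trans _ Fx) // ler_expR lerN2 ler_nat.
  - by move=> n; apply: measurable_funS (sub n) _ => //; exact/measurable_EFinP.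
  - move=> n x /sub /=; rewrite in_itv /= => /andP[x0 x1].
    by rewrite lee_fin divr_ge0 ?(ltW x0) // g0 // oppr_ge0 ln_le0.
have cvgR : (\int[mu]_(t in `[0%R, n%:R]) (g t)%:E @[n --> \oo] -->
    \int[mu]_(t in `[0%R, +oo[) (g t)%:E)%E.
  have -> : `[0, +oo[%classic = \bigcup_n `[(0 : R), n%:R]%classic.
    apply/seteqP; split => x /=.
      rewrite in_itv /= andbT => x0; exists (Num.bound x) => //=.
      by rewrite in_itv /= x0 ltW // archi_boundP.
    by move=> [n _ /=]; rewrite !in_itv /= => /andP[->].
  apply: ge0_nondecreasing_set_cvg_integral => //.
  - move=> i j ij; apply/subsetPset => x /=; rewrite !in_itv /= => /andP[-> xi].
    by rewrite (le_trans xi) // ler_nat.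
  - by move=> n; exact: continuous_measurable_EFin.
  - by move=> n x /=; rewrite in_itv /= => /andP[x0 _]; rewrite lee_fin g0.
rewrite -(cvg_lim _ cvgR) // -(cvg_lim _ cvgL) //.
by congr (limn _); apply/funext => n; exact: step.
Qed.

End exp_substitution.

(** * Convergence of [E_m] and [Q_m] to [L1] and [L2] *)

Section miss_limits.
Context {R : realType}.
Variables (m : nat) (a : nat -> R).
Hypothesis a_gt0 : forall j, 0 < a j.
Notation mu := (@lebesgue_measure R).
Implicit Types (N n : nat) (t : R).

Lemma missS N t : miss m a N.+1 t = miss m a N t +
  (1 - miss m a N t) * surv m (a N * t).
Proof. by rewrite /miss big_ord_recr /=; ring. Qed.

Lemma miss0 t : miss m a 0 t = 0.
Proof. by rewrite /miss big_ord0 subrr. Qed.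

Lemma miss_ge0_le1 N t : 0 <= t -> 0 <= miss m a N t <= 1.
Proof.
move=> t0; rewrite /miss subr_ge0 gerBl.
have H (j : 'I_N) : 0 <= 1 - surv m (a j * t) <= 1.
  have at0 : 0 <= a j * t by rewrite mulr_ge0 // ltW.
  by rewrite subr_ge0 surv_le1 // gerBl surv_ge0.
rewrite prodr_ge0; last by move=> j _; have /andP[] := H j.
by rewrite andbT; apply: prodr_ile1 => j _; exact: H.
Qed.

Lemma miss_ndecr t : 0 <= t -> {homo (fun N => miss m a N t) : N M / (N <= M)%N >-> N <= M}.
Proof.
move=> t0; apply/nondecreasing_seqP => N; rewrite missS lerDl mulr_ge0 //.
  by rewrite subr_ge0; have /andP[] := miss_ge0_le1 N t0.
by rewrite surv_ge0 // mulr_ge0 // ltW.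
Qed.

Lemma continuous_miss N : continuous (miss m a N).
Proof.
elim: N => [|N IH] t.
  rewrite (_ : miss m a 0 = cst 0); first exact: cst_continuous.
  by apply/funext => x; exact: miss0.
rewrite (_ : miss m a N.+1 = fun t => miss m a N t + (1 - miss m a N t) * surv m (a N * t)); last first.
  by apply/funext => x; exact: missS.
apply: cvgD; first exact: IH.
apply: cvgM; first by apply: cvgB; [exact: cvg_cst|exact: IH].
apply: (@continuous_comp _ _ _ (fun t => a N * t) (surv m)); last exact: continuous_surv.
by apply: cvgMr; exact: cvg_id.
Qed.

(** With t = -ln x the partial products are 1 - [miss m a N t]; they are nonincreasing and bounded
    below by 0, so the [limn] in [inf_prod] is a genuine limit. *)
Lemma inf_prod_cvg x : 0 < x < 1 ->
  miss m a N (- ln x) @[N --> \oo] --> 1 - inf_prod m a x.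
Proof.
move=> /andP[x0 x1]; have t0 : 0 <= - ln x by rewrite oppr_ge0 ln_le0 // ltW.
have E N : \prod_(j < N) (1 - x `^ (a j) * exp_trunc m (- a j * ln x)) = 1 - miss m a N (- ln x).
  rewrite /miss opprB addrCA subrr addr0; apply: eq_bigr => j _; rewrite /surv mulrN opprK.
  by rewrite /powR gt_eqF // -mulNr.
have c : cvgn (fun N => 1 - miss m a N (- ln x)).
  apply: nonincreasing_is_cvgn.
    by move=> N M NM; rewrite lerB // miss_ndecr.
  by exists 0 => _ [N _ <-]; rewrite subr_ge0; have /andP[] := miss_ge0_le1 N t0.
rewrite /inf_prod (funext E).
rewrite (_ : (fun N => miss m a N (- ln x)) = (fun N => 1 - (1 - miss m a N (- ln x)))); last first.
  by apply/funext => N; rewrite opprB addrCA subrr addr0.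
by apply: cvgB => //; exact: cvg_cst.
Qed.

(** Monotone convergence after the substitution. The weight [w] is 1 for [E_m] and t for [Q_m]. *)
Lemma integral_miss_cvg (w : R -> R) : continuous w -> (forall t, 0 <= t -> 0 <= w t) ->
  (\int[mu]_(t in `[0%R, +oo[) (w t * miss m a N t)%:E @[N --> \oo] -->
   \int[mu]_(x in `]0%R, 1%R[) ((1 - inf_prod m a x) * (w (- ln x) / x))%:E)%E.
Proof.
move=> cw w0.
have cwm N : continuous (fun t => w t * miss m a N t).
  by move=> t; apply: cvgM; [exact: cw|exact: continuous_miss].
have t0 (x : R) : x \in `]0, 1[ -> 0 <= - ln x.
  by move=> /[!in_itv]/= /andP[x0 x1]; rewrite oppr_ge0 ln_le0 // ltW.
have -> : (fun N => \int[mu]_(t in `[0%R, +oo[) (w t * miss m a N t)%:E)%E =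
    (fun N => \int[mu]_(x in `]0%R, 1%R[) (w (- ln x) * miss m a N (- ln x) / x)%:E)%E.
  apply/funext => N; rewrite (integral_expRN_substitution (cwm N)) // => t t_ge0.
  by rewrite mulr_ge0 ?w0 //; have /andP[] := miss_ge0_le1 N t_ge0.
have -> : (\int[mu]_(x in `]0%R, 1%R[) ((1 - inf_prod m a x) * (w (- ln x) / x))%:E =
   \int[mu]_(x in `]0%R, 1%R[) limn (fun N => (w (- ln x) * miss m a N (- ln x) / x)%:E))%E.
  apply: eq_integral => x /[!inE]/= xI; apply/esym/cvg_lim => //.
  apply: cvg_EFin; first exact: nearW.
  rewrite /comp /=.
  rewrite (_ : (fun _ => _) = (fun N => miss m a N (- ln x) * (w (- ln x) / x))); last first.
    by apply/funext => N; ring.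
  by apply: cvgMl; apply: inf_prod_cvg; move: xI; rewrite in_itv.
apply: cvg_monotone_convergence => //.
- by move=> N; exact: (@measurable_log_pullback _ (fun t => w t * miss m a N t)).
- move=> N x /= xI; have := t0 x xI; move: xI; rewrite in_itv /= => /andP[x0 _] lx0.
  by rewrite lee_fin divr_ge0 ?(ltW x0) // mulr_ge0 ?w0 //; have /andP[] := miss_ge0_le1 N lx0.
- move=> x /= xI N M NM; have := t0 x xI; move: xI; rewrite in_itv /= => /andP[x0 _] lx0.
  by rewrite lee_fin ler_wpM2r ?invr_ge0 ?(ltW x0) // ler_wpM2l ?w0 // miss_ndecr.
Qed.

Lemma inf_prod_le1 x : 0 < x < 1 -> inf_prod m a x <= 1.
Proof.
move=> x01; rewrite -subr_ge0 -(cvg_lim _ (inf_prod_cvg x01)) //.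
apply: limr_ge; first by apply/cvg_ex; exists (1 - inf_prod m a x); exact: inf_prod_cvg.
have t0 : 0 <= - ln x by case/andP: x01 => x0 x1; rewrite oppr_ge0 ln_le0 // ltW.
by apply: nearW => N; have /andP[] := miss_ge0_le1 N t0.
Qed.

Lemma E_m_cvg : E_m m a @ \oo --> L1 m a.
Proof.
have := integral_miss_cvg (@cst_continuous _ _ (1 : R)) (fun _ _ => ler01).
rewrite (_ : L1 m a = \int[mu]_(x in `]0%R, 1%R[) ((1 - inf_prod m a x) * (cst 1 (- ln x) / x))%:E)%E.
  rewrite (_ : E_m m a = fun N => \int[mu]_(t in `[0%R, +oo[) (cst 1 t * miss m a N t)%:E)%E //.
  by apply/funext => N; apply: eq_integral => t _; rewrite mul1r.
by apply: eq_integral => x _; rewrite mul1r.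
Qed.

Lemma Q_m_cvg : Q_m m a @ \oo --> L2 m a.
Proof.
have h := @integral_miss_cvg id ltac:(by move=> x; exact: cvg_id) ltac:(by []).
have := cvgeZl (_ : (2 : R)%:E \is a fin_num) h.
move=> /(_ isT).
rewrite (_ : L2 m a = 2%:E * \int[mu]_(x in `]0%R, 1%R[) ((1 - inf_prod m a x) * (- ln x / x))%:E)%E //.
pose g (x : R) := (1 - inf_prod m a x) * (- ln x / x).
(* The minus sign of [L2] is moved inside the integral, where it turns ln x into the nonnegative -ln
   x. *)
rewrite /L2 mulNe -muleN; congr (_ * _)%E.
transitivity (- \int[mu]_(x in `]0%R, 1%R[) (- (g x)%:E))%E.
  by congr (- _)%E; apply: eq_integral => x _; rewrite -EFinN /g; congr (_ %:E); ring.
rewrite integral_ge0N ?oppeK // => x /=; rewrite in_itv /= => x01; have /andP[x0 x1] := x01.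
rewrite lee_fin mulr_ge0 ?divr_ge0 ?(ltW x0) //.
  by rewrite subr_ge0 inf_prod_le1.
by rewrite oppr_ge0 ln_le0 // ltW.
Qed.

End miss_limits.

(** * Consequences of the finiteness of [L1] *)

Section finite_L1.
Context {R : realType}.
Variables (m : nat) (a : nat -> R).
Hypothesis a_gt0 : forall j, 0 < a j.
Notation mu := (@lebesgue_measure R).
Implicit Types (N n : nat) (t : R).

(** The exponential splits as e^(-(s-1)y) e^(-y), and each power s^k with k < m is at most s^m. This
    transfers a bound at one time to exponential decay at later times. *)
Lemma surv_scale (s y : R) : 1 <= s -> 0 <= y ->
  surv m (s * y) <= s ^+ m * expR (- ((s - 1) * y)) * surv m y.
Proof.
move=> s1 y0; have s0 : 0 <= s := le_trans ler01 s1.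
rewrite /surv (_ : - (s * y) = - ((s - 1) * y) - y); last by ring.
rewrite expRD [leRHS](_ : _ = expR (- ((s - 1) * y)) * expR (- y) * (s ^+ m * exp_trunc m y)).
  rewrite ler_wpM2l ?mulr_ge0 ?expR_ge0 //.
  rewrite /exp_trunc mulr_sumr; apply: ler_sum => k _.
  rewrite exprMn -mulrA ler_wpM2r ?divr_ge0 ?exprn_ge0 //.
  by rewrite ler_weXn2l // ltnW.
by ring.
Qed.

Lemma measurable_miss N (D : set R) : measurable_fun D (fun t => (miss m a N t)%:E).
Proof. by apply: continuous_measurable_EFin; exact: continuous_miss. Qed.

Lemma measurable_mul_miss N (D : set R) : measurable_fun D (fun t => (t * miss m a N t)%:E).
Proof.
by apply: continuous_measurable_EFin => t; apply: cvgM; [exact: cvg_id|exact: continuous_miss].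
Qed.

Lemma miss_ge0 N t : 0 <= t -> 0 <= miss m a N t.
Proof. by move=> t0; have /andP[] := miss_ge0_le1 m a_gt0 N t0. Qed.

Lemma miss_le1 N t : 0 <= t -> miss m a N t <= 1.
Proof. by move=> t0; have /andP[] := miss_ge0_le1 m a_gt0 N t0. Qed.

Lemma miss_nincr N s t : 0 <= s -> s <= t -> miss m a N t <= miss m a N s.
Proof.
move=> s0 st; rewrite lerB //; apply: ler_prod => j _.
have as0 : 0 <= a j * s by rewrite mulr_ge0 // ltW.
by rewrite subr_ge0 surv_le1 //= lerB // surv_nincr // ler_wpM2l // ltW.
Qed.

Lemma miss_le_sum N t : 0 <= t -> miss m a N t <= \sum_(j < N) surv m (a j * t).
Proof.
move=> t0; elim: N => [|N IH]; first by rewrite miss0 big_ord0.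
rewrite missS big_ord_recr /= lerD // ler_piMl //.
  by rewrite surv_ge0 // mulr_ge0 // ltW.
by rewrite gerBl miss_ge0.
Qed.

(** The first type alone gives a lower bound that does not depend on [N]. *)
Lemma miss_ge_surv N t : 0 <= t -> surv m (a 0%N * t) <= miss m a N.+1 t.
Proof.
move=> t0; apply: le_trans (miss_ndecr m a_gt0 t0 (ltn0Sn N)).
by rewrite missS miss0 subr0 mul1r add0r.
Qed.

(** For x_j in [0, 1] the product of the 1 - x_j is at most 1 / (1 + sum of the x_j): adding a
    factor 1 - x changes (1 - u)(1 + S) by -(1 - u)(xS + x^2). A bound on [miss] away from 1 thus
    bounds the sum of the tails. *)
Lemma miss_sum_le N t : 0 <= t ->
  (1 - miss m a N t) * (1 + \sum_(j < N) surv m (a j * t)) <= 1.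
Proof.
move=> t0; elim: N => [|N IH]; first by rewrite miss0 big_ord0; lra.
have at0 : 0 <= a N * t by rewrite mulr_ge0 // ltW.
rewrite missS big_ord_recr /=; apply: le_trans IH.
have := surv_ge0 m at0; have := miss_le1 N t0.
have : 0 <= \sum_(j < N) surv m (a j * t).
  by apply: sumr_ge0 => j _; rewrite surv_ge0 // mulr_ge0 // ltW.
move: (miss m a N t) (surv m (a N * t)) (\sum_(j < N) _) => u x S S0 u1 x0.
rewrite -subr_ge0 (_ : _ - _ = (1 - u) * (x * S + x ^+ 2)); last by ring.
by rewrite mulr_ge0 ?subr_ge0 // addr_ge0 ?sqr_ge0 // mulr_ge0.
Qed.

Lemma E_m_ge0 N : (0 <= E_m m a N)%E.
Proof.
rewrite E_m_miss; apply: integral_ge0 => t /=; rewrite in_itv /= andbT => t0.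
by rewrite lee_fin miss_ge0.
Qed.

Lemma Q_m_ge0 N : (0 <= Q_m m a N)%E.
Proof.
rewrite Q_m_miss mule_ge0 //; apply: integral_ge0 => t /=; rewrite in_itv /= andbT => t0.
by rewrite lee_fin mulr_ge0 ?miss_ge0.
Qed.

Lemma E_m_le_L1 N : (E_m m a N <= L1 m a)%E.
Proof.
have nd : nondecreasing_seq (E_m m a).
  move=> n n' nn'; apply: ge0_le_integral => //=.
  - by move=> t; rewrite in_itv /= andbT => t0; rewrite lee_fin miss_ge0.
  - exact: measurable_miss.
  - exact: measurable_miss.
  - by move=> t; rewrite in_itv /= andbT => t0; rewrite lee_fin; exact: miss_ndecr.
rewrite -(cvg_lim _ (@E_m_cvg _ m _ a_gt0)) //.
rewrite (cvg_lim _ (ereal_nondecreasing_cvgn nd)) //.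
by apply: ereal_sup_ubound; exists N.
Qed.

(** Markov's inequality: [miss] is nonincreasing, so its integral over [0, t] is at least t times
    its value at t. *)
Lemma markov_miss N t : 0 < t -> ((t * miss m a N t)%:E <= E_m m a N)%E.
Proof.
move=> t0; have sub : `[0, t]%classic `<=` `[0, +oo[%classic.
  by move=> x /=; rewrite !in_itv /= => /andP[->].
apply: (@le_trans _ _ (\int[mu]_(x in `[0%R, t]) (miss m a N x)%:E)%E); last first.
  apply: ge0_subset_integral => //=; first exact: measurable_miss.
  by move=> x; rewrite in_itv /= andbT => x0; rewrite lee_fin miss_ge0.
apply: (@le_trans _ _ (\int[mu]_(x in `[0%R, t]) (cst (miss m a N t)%:E x))%E).
  rewrite integral_cst //= lebesgue_measure_itv /= lte_fin t0 oppr0 adde0.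
  by rewrite -EFinM mulrC.
apply: ge0_le_integral => //=.
- by move=> x _; rewrite lee_fin miss_ge0 // ltW.
- exact: measurable_miss.
- by move=> x; rewrite in_itv /= => /andP[x0 xt]; rewrite lee_fin miss_nincr.
Qed.

Hypothesis m_gt0 : (0 < m)%N.
Hypothesis L1_fin : (L1 m a < +oo)%E.

Lemma fin_num_L1 : L1 m a \is a fin_num.
Proof. by rewrite ge0_fin_numE // (le_trans (E_m_ge0 0)) // E_m_le_L1. Qed.

Lemma fin_num_E_m N : E_m m a N \is a fin_num.
Proof. by rewrite ge0_fin_numE ?E_m_ge0 // (le_lt_trans (E_m_le_L1 N)). Qed.

Lemma fine_E_m_gt0 N : 0 < fine (E_m m a N.+1).
Proof.
rewrite -lte_fin fineK ?fin_num_E_m //; apply: lt_le_trans (markov_miss N.+1 ltr01).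
by rewrite lte_fin mul1r (lt_le_trans _ (miss_ge_surv N ler01)) // surv_gt0 // mulr_ge0 // ltW.
Qed.

Let l := fine (L1 m a).

Let l_ge0 : 0 <= l.
Proof. by rewrite fine_ge0 // (le_trans (E_m_ge0 0)) // E_m_le_L1. Qed.

(** Large enough for Markov's inequality to give [miss] <= 1/2 at [t0]; the added 1 also ensures t /
    t0 <= t. *)
Let t0 := 2 * l + 1.

Let t0_ge1 : 1 <= t0.
Proof. by rewrite /t0 lerDr mulr_ge0. Qed.

Let t0_gt0 : 0 < t0.
Proof. exact: lt_le_trans ltr01 t0_ge1. Qed.

(** At [t0] one has [miss] <= 1/2, so [miss_sum_le] yields 1 + sum <= 2. *)
Lemma sum_surv_le1 N : \sum_(j < N) surv m (a j * t0) <= 1.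
Proof.
have h : t0 * miss m a N t0 <= l.
  rewrite -lee_fin (le_trans (markov_miss N t0_gt0)) // /l fineK ?fin_num_L1 //.
  exact: E_m_le_L1.
have h2 : miss m a N t0 <= 2^-1.
  move: h l_ge0; move: (miss m a N t0) => M; rewrite /t0; move: l => x h x0; nra.
have := miss_sum_le N (ltW t0_gt0).
have : 0 <= \sum_(j < N) surv m (a j * t0).
  by apply: sumr_ge0 => j _; rewrite surv_ge0 // mulr_ge0 // ltW.
by move: h2; move: (miss m a N t0) (\sum_(j < N) _) => M S; nra.
Qed.

(** The series of the tails at [t0] is bounded, so its terms tend to 0. A weight a_j < 1 would keep
    its term at least [surv m t0] > 0, hence a_j >= 1 from some rank [K] on; the finitely many
    earlier weights have a positive minimum. *)
Lemma weights_bounded_below : exists2 c : R, 0 < c & forall j, c <= a j.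
Proof.
have cv : (fun j => surv m (a j * t0)) @ \oo --> (0 : R).
  apply: cvg_series_cvg_0; apply: nondecreasing_is_cvgn.
    apply/nondecreasing_seqP => n; rewrite seriesSr lerDl.
    by rewrite surv_ge0 // mulr_ge0 // ltW.
  by exists 1 => _ [n _ <-]; rewrite /series /= big_mkord sum_surv_le1.
have s0 : 0 < surv m t0 by rewrite surv_gt0 // ltW.
have [K _ HK] : \forall j \near \oo, surv m (a j * t0) < surv m t0.
  exact: (cvgr_lt _ cv _ s0).
have big j : (K <= j)%N -> 1 <= a j.
  move=> /HK /=; rewrite leNgt => h; apply/negP => aj; move: h; rewrite ltNge surv_nincr //.
    by rewrite mulr_ge0 ?ltW.
  by rewrite ger_pMl // ltW.
have [c c0 Hc] : exists2 c : R, 0 < c & forall j, (j < K)%N -> c <= a j.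
  elim: {HK big} K => [|K [c c0 Hc]]; first by exists 1.
  exists (Order.min c (a K)); first by rewrite lt_min c0 a_gt0.
  move=> j; rewrite ltnS leq_eqVlt => /predU1P[->|/Hc cj].
    by rewrite ge_min lexx orbT.
  by rewrite ge_min cj.
exists (Order.min 1 c); first by rewrite lt_min ltr01.
by move=> j; have [/Hc h|/big h] := ltnP j K; rewrite ge_min h ?orbT.
Qed.

Lemma partial_weight_cvgy : partial_weight a @ \oo --> +oo.
Proof.
have [c c0 ca] := weights_bounded_below.
have h N : N%:R * c <= partial_weight a N.
  rewrite /partial_weight -[N in N%:R]card_ord mulr_natl -sumr_const.
  by apply: ler_sum => j _; exact: ca.
apply: (@ger_cvgy _ _ _ _ (fun N => N%:R * c : R)); first exact: nearW.
apply: (@cvg_comp _ _ _ (fun n => n%:R : R) (fun r => r * c) _ (pinfty_nbhs R)); first exact: cvgr_idn.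
by apply: gt0_cvgMly => //; exact: cvg_id.
Qed.

(** Before [t0], [miss] is bounded by 1; after it, by the sum of the tails, which decays
    exponentially. Poisson weights serve as dominating functions because [integral_pois] integrates
    them. *)
Lemma miss_le_exp : exists c K0 K1 : R, [/\ 0 < c, 0 <= K0, 0 <= K1 &
  forall N t, 0 <= t -> t * miss m a N t <= K0 * pois 0 (1 * t) + K1 * pois m.+1 (c * t)].
Proof.
have [c c0 ca] := weights_bounded_below.
(* [K0] makes K0 e^(-t) >= t0 on [0, t0]; [K1] is normalised so that K1 [pois m.+1 (c * t)] =
   t^(m+1) e^(-c(t - t0)). *)
pose K0 := t0 * expR t0.
pose K1 := expR (c * t0) * (m.+1)`!%:R / c ^+ m.+1.
have K00 : 0 <= K0 by rewrite mulr_ge0 ?expR_ge0 // ltW.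
have K10 : 0 <= K1.
  by apply: divr_ge0; [rewrite mulr_ge0 ?expR_ge0|rewrite exprn_ge0 // ltW].
exists c, K0, K1; split => // N t t_ge0.
have P0 : 0 <= K0 * pois 0 (1 * t) by rewrite mulr_ge0 // pois_ge0 // mul1r.
have P1 : 0 <= K1 * pois m.+1 (c * t).
  by rewrite mulr_ge0 // pois_ge0 // mulr_ge0 // ltW.
have [tt0|t0t] := leP t t0.
  apply: (@le_trans _ _ (K0 * pois 0 (1 * t))); last by rewrite lerDl.
  rewrite /pois expr0 divr1 mulr1 mul1r /K0 -mulrA -expRD.
  apply: (@le_trans _ _ (t0 * 1)).
    by rewrite ler_pM ?miss_ge0 ?miss_le1.
  rewrite ler_wpM2l ?(ltW t0_gt0) // -expR0 ler_expR; lra.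
apply: (@le_trans _ _ (K1 * pois m.+1 (c * t))); last by rewrite lerDr.
have -> : K1 * pois m.+1 (c * t) = t * (t ^+ m * expR (- (c * (t - t0)))).
  rewrite /K1 /pois exprMn (_ : - (c * (t - t0)) = c * t0 - c * t); last by ring.
  rewrite expRD.
  have : c ^+ m.+1 != 0 by rewrite expf_neq0 // gt_eqF.
  have : (m.+1)`!%:R != 0 :> R by rewrite pnatr_eq0 -lt0n fact_gt0.
  rewrite [t ^+ m.+1]exprS.
  move: ((m.+1)`!%:R : R) (c ^+ m.+1) (expR _) (expR _) => f d e1 e2 f0 d0.
  by field; apply/andP.
rewrite ler_wpM2l //; apply: le_trans (miss_le_sum N t_ge0) _.
(* Dilation by s = t / t0 carries t0 to t: (s - 1) a_j t0 = a_j (t - t0) >= c (t - t0), and s^m <=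
   t^m because t0 >= 1. *)
have st j : surv m (a j * t) <= t ^+ m * expR (- (c * (t - t0))) * surv m (a j * t0).
  have at0 : 0 <= a j * t0 by rewrite mulr_ge0 // ltW.
  have s1 : 1 <= t / t0 by rewrite ler_pdivlMr // mul1r ltW.
  rewrite (_ : a j * t = t / t0 * (a j * t0)); last by field; rewrite gt_eqF.
  apply: le_trans (surv_scale s1 at0) _.
  rewrite ler_wpM2r ?surv_ge0 // ler_pM ?exprn_ge0 ?expR_ge0 ?divr_ge0 // ?(ltW t0_gt0) //.
    by rewrite lerXn2r ?nnegrE // ?divr_ge0 ?(ltW t0_gt0) // ler_pdivrMr // ler_peMr.
  rewrite ler_expR lerN2 (_ : (t / t0 - 1) * (a j * t0) = a j * (t - t0)).
    by rewrite ler_wpM2r // subr_ge0 ltW.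
  by field; rewrite gt_eqF.
apply: (@le_trans _ _ (\sum_(j < N) t ^+ m * expR (- (c * (t - t0))) * surv m (a j * t0))).
  by apply: ler_sum => j _; exact: st.
rewrite -mulr_sumr ler_piMr ?sum_surv_le1 // mulr_ge0 ?expR_ge0 // exprn_ge0 //.
Qed.

Lemma Q_m_bounded : exists M : R, forall N, (Q_m m a N <= M%:E)%E.
Proof.
have [c [K0 [K1 [c0 K00 K10 H]]]] := miss_le_exp.
exists (2 * (K0 + K1 / c)) => N.
rewrite Q_m_miss EFinM lee_wpmul2l //.
have mp (K b : R) k : measurable_fun `[(0 : R), +oo[ (fun t : R => (K * pois k (b * t))%:E).
  by apply: continuous_measurable_EFin => t; apply: cvgMr; exact: continuous_pois_scaled.
have pp (K b t : R) k : 0 <= K -> 0 <= b -> t \in `[0, +oo[ -> 0 <= K * pois k (b * t).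
  by move=> K_ge0 b0; rewrite in_itv /= andbT => t_ge0; rewrite mulr_ge0 // pois_ge0 // mulr_ge0.
have ip (K b : R) k : 0 <= K -> 0 < b ->
    (\int[mu]_(t in `[0%R, +oo[) (K * pois k (b * t))%:E = (K / b)%:E)%E.
  move=> K_ge0 b0; under eq_integral do rewrite EFinM.
  rewrite ge0_integralZl_EFin //=.
  - by rewrite integral_pois.
  - by move=> t tI; have := pp 1 b t k ler01 (ltW b0) tI; rewrite mul1r lee_fin.
  - by apply: continuous_measurable_EFin; exact: continuous_pois_scaled.
apply: (@le_trans _ _ (\int[mu]_(t in `[0%R, +oo[)
    ((K0 * pois 0 (1 * t))%:E + (K1 * pois m.+1 (c * t))%:E))%E).
  apply: ge0_le_integral => //=.
  - by move=> t; rewrite in_itv /= andbT => t_ge0; rewrite lee_fin mulr_ge0 // miss_ge0.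
  - exact: measurable_mul_miss.
  - by apply: emeasurable_funD; exact: mp.
  - by move=> t; rewrite in_itv /= andbT => t_ge0; rewrite -EFinD lee_fin H.
rewrite ge0_integralD //=.
- by rewrite !ip // -EFinD divr1.
- by move=> t tI; rewrite lee_fin pp.
- exact: mp.
- by move=> t tI; rewrite lee_fin pp // ltW.
- exact: mp.
Qed.

Lemma fin_num_L2 : L2 m a \is a fin_num.
Proof.
have [M HM] := Q_m_bounded.
have cQ := @Q_m_cvg _ m _ a_gt0.
have cQ' : cvgn (Q_m m a) by apply/cvg_ex; exists (L2 m a).
rewrite -(cvg_lim _ cQ) // ge0_fin_numE.
  apply: (@le_lt_trans _ _ M%:E); last exact: ltry.
  by apply: lime_le => //; exact: nearW.
by apply: lime_ge => //; apply: nearW => N; exact: Q_m_ge0.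
Qed.

Lemma fin_num_Q_m N : Q_m m a N \is a fin_num.
Proof.
have [M HM] := Q_m_bounded.
by rewrite ge0_fin_numE ?Q_m_ge0 // (le_lt_trans (HM N)) // ltry.
Qed.

(** Twice the area of a triangle: the share of the indicator of [0, e] in the integral computed for
    [Q_m_gap]. *)
Let integral_ramp (e : R) : 0 < e ->
  (\int[mu]_(t in `[0%R, +oo[) (2 * (e - t) * \1_`[0, e] t)%:E = (e ^+ 2)%:E)%E.
Proof.
move=> e0; transitivity (\int[mu]_(t in `[0%R, e]) (2 * (e - t))%:E)%E.
  rewrite [in RHS](_ : `[0, e]%classic = `[0, +oo[ `&` `[0, e])%classic; last first.
    apply/seteqP; split => t /=; rewrite !in_itv /=; last by case.
    by move=> /andP[-> ->].
  rewrite integral_mkcondr; apply: eq_integral => t _.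
  by rewrite epatch_indic EFinM.
have dF (t : R) : is_derive t 1 (fun t => 2 * e * t - t ^+ 2) (2 * (e - t)).
  have h1 := @is_deriveZ _ _ _ (@id R) (2 * e) t 1 1 (is_derive_id _ _).
  have h2 := is_deriveM (is_derive_id t 1) (is_derive_id t 1).
  rewrite (_ : (fun t => _) = (2 * e) *: (id : R -> R) - (id : R -> R) * id); last first.
    by apply/funext => x; rewrite !fctE.
  by apply: (is_derive_eq (is_deriveB h1 h2)); rewrite /GRing.scale /=; ring.
have cF : continuous (fun t : R => 2 * e * t - t ^+ 2).
  by move=> t; apply: differentiable_continuous; apply/derivable1_diffP; have [] := dF t.
rewrite (@continuous_FTC2 _ _ (fun t => 2 * e * t - t ^+ 2)) //.
- by rewrite -EFinB; congr (_ %:E); ring.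
- apply: continuous_subspaceT => t; apply: cvgMr; apply: cvgB; [exact: cvg_cst|exact: cvg_id].
- split; [by move=> t _; have [] := dF t|by apply: cvg_at_right_filter; exact: cF|].
  by apply: cvg_at_left_filter; exact: cF.
- by move=> t _; rewrite derive1E; have [_ ->] := dF t.
Qed.

(* With e := E_m N and F := miss N in [0, 1], the function (t - e)(F t - 1_[0,e])
   is nonnegative, and its integral is (Q_m N - e^2) / 2. *)
Lemma Q_m_gap : exists2 eps : R, 0 < eps &
  forall N, fine (E_m m a N.+1) ^+ 2 + eps <= fine (Q_m m a N.+1).
Proof.
(* On [l + 1, l + 2] one has t - e >= 1, since e <= l, and [miss] >= s by the first type. This
   interval of length 1 gives the gap 2s, whatever the value of [N]. *)
pose s := surv m (a 0%N * (l + 2)).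
have l20 : 0 <= l + 2 by rewrite addr_ge0.
have s0 : 0 < s by rewrite surv_gt0 // mulr_ge0 // ltW.
exists (2 * s); first by rewrite mulr_gt0.
move=> N; set e := fine (E_m m a N.+1).
have Ee : E_m m a N.+1 = e%:E by rewrite fineK ?fin_num_E_m.
have el : e <= l by rewrite fine_le ?fin_num_E_m ?fin_num_L1 ?E_m_le_L1.
have e0 : 0 < e by exact: fine_E_m_gt0.
pose g (t : R) : R := 2 * s * \1_`[l + 1, l + 2] t.
have mg : measurable_fun `[(0 : R), +oo[%classic (fun t => (g t)%:E).
  by apply/measurable_EFinP; apply: measurable_funM => //; exact: measurable_indic.
have g0 t : 0 <= g t by rewrite /g indicE mulr_ge0 // mulr_ge0 // ltW.
have ig : (\int[mu]_(t in `[0%R, +oo[) (g t)%:E = (2 * s)%:E)%E.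
  under eq_integral do rewrite EFinM.
  rewrite ge0_integralZl_EFin //=.
  - rewrite integral_indic // setIidl; last first.
      move=> t /=; rewrite !in_itv /= andbT => /andP[h _]; apply: le_trans h.
      by rewrite addr_ge0.
    rewrite /= lebesgue_measure_itv /= lte_fin ltrD2l ltr1n -EFinB -EFinM.
    by congr (_ %:E); ring.
  - by apply/measurable_EFinP; exact: measurable_indic.
  - by rewrite mulr_ge0 // ltW.
have mr : measurable_fun `[(0 : R), +oo[%classic (fun t : R => (2 * (e - t) * \1_`[0, e] t)%:E).
  apply/measurable_EFinP; apply: measurable_funM; last exact: measurable_indic.
  by apply: measurable_funM => //; exact: measurable_funB.
have r0 (t : R) : t \in `[0, +oo[ -> 0 <= 2 * (e - t) * \1_`[0, e] t.
  rewrite in_itv /= andbT => t_ge0; rewrite indicE.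
  case: (boolP (t \in _)) => [|_]; last by rewrite mulr0.
  by rewrite inE /= in_itv /= => /andP[_ te]; rewrite mulr1 mulr_ge0 // subr_ge0.
have mF := @measurable_miss N.+1 `[(0 : R), +oo[%classic.
have mtF := @measurable_mul_miss N.+1 `[(0 : R), +oo[%classic.
have F0 (t : R) : t \in `[0, +oo[ -> 0 <= miss m a N.+1 t.
  by rewrite in_itv /= andbT => t_ge0; rewrite miss_ge0.
have tF0 (t : R) : t \in `[0, +oo[ -> 0 <= t * miss m a N.+1 t.
  by rewrite in_itv /= andbT => t_ge0; rewrite mulr_ge0 // miss_ge0.
(* The inequality g <= 2 (t - e)(F - 1_[0,e]) is rearranged so that both sides are sums of
   nonnegative terms and can be integrated separately. *)
have : (\int[mu]_(t in `[0%R, +oo[) ((2 * e)%:E * (miss m a N.+1 t)%:E + (g t)%:E) <=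
        \int[mu]_(t in `[0%R, +oo[) (2%:E * (t * miss m a N.+1 t)%:E +
           (2 * (e - t) * \1_`[0, e] t)%:E))%E.
  apply: ge0_le_integral => //.
  - move=> t tI; rewrite -EFinM -EFinD lee_fin addr_ge0 // mulr_ge0 ?F0 //.
    by rewrite mulr_ge0 // ltW.
  - by apply: emeasurable_funD => //; apply: measurable_funeM.
  - by apply: emeasurable_funD => //; apply: measurable_funeM.
  move=> t tI; have Ft := F0 t tI; move: tI => /=; rewrite in_itv /= andbT => t_ge0.
  have F1 := miss_le1 N.+1 t_ge0.
  rewrite -!EFinM -!EFinD lee_fin /g !indicE.
  case: (boolP (t \in `[0, e]%classic)) => [|]; rewrite ?inE /= => tE.
    have te : t <= e by move: tE; rewrite in_itv /= => /andP[].
    rewrite memNset /=; last by rewrite in_itv /= => /andP[]; lra.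
    rewrite mulr0 addr0 mulr1; nra.
  have te : e < t.
    by rewrite ltNge; apply/negP => te; apply/negP: tE; rewrite negbK inE /= in_itv /= t_ge0.
  rewrite mulr0 addr0.
  case: (boolP (t \in `[l + 1, l + 2]%classic)) => [|]; rewrite ?inE /= => tl; last by nra.
  move: tl; rewrite in_itv /= => /andP[l1 l2].
  have sF : s <= miss m a N.+1 t.
    apply: le_trans (miss_ge_surv N t_ge0); rewrite surv_nincr ?mulr_ge0 ?(ltW (a_gt0 _)) //.
    by rewrite ler_wpM2l // ltW.
  nra.
have I1 : (\int[mu]_(t in `[0%R, +oo[) ((2 * e)%:E * (miss m a N.+1 t)%:E + (g t)%:E) =
    (2 * e * e + 2 * s)%:E)%E.
  rewrite ge0_integralD //.
  - rewrite ig ge0_integralZl_EFin //.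
    + by rewrite -E_m_miss Ee -EFinM -EFinD.
    + by rewrite mulr_ge0 // ltW.
  - by move=> t tI; rewrite -EFinM lee_fin mulr_ge0 ?F0 // mulr_ge0 // ltW.
  - exact: measurable_funeM.
  - by move=> t _; rewrite lee_fin.
have I2 : (\int[mu]_(t in `[0%R, +oo[) (2%:E * (t * miss m a N.+1 t)%:E +
           (2 * (e - t) * \1_`[0, e] t)%:E) = (fine (Q_m m a N.+1) + e ^+ 2)%:E)%E.
  rewrite ge0_integralD //.
  - rewrite integral_ramp // ge0_integralZl_EFin //.
    by rewrite -Q_m_miss EFinD fineK // fin_num_Q_m.
  - by move=> t tI; rewrite -EFinM lee_fin mulr_ge0 ?tF0.
  - exact: measurable_funeM.
rewrite I1 I2 lee_fin; lra.
Qed.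

End finite_L1.

Local Open Scope ereal_scope.

(** * Moments of the collection time as series *)

Section unmet_probability.
Context d (Omega : measurableType d) (R : realType) (P : probability Omega R).
Variables (N : nat) (p : nat -> R) (X : nat -> {RV P >-> nat}).
Implicit Types (r : nat -> nat) (n : nat).

(** For constant [r] equal to [m] this is the complement of [collected]. Requirements that vary with
    the type are what the recursion on draws produces. *)
Definition unmet r n : set Omega :=
  [set w | ~ forall j, (j < N)%N -> (r j <= \sum_(k < n) (X k w == j))%N].

(** The last of the [n.+1] draws, [X n], is charged to the requirement; a requirement already at 0
    stays there. *)
Lemma unmetS r n w : unmet r n.+1 w <-> unmet (draw r (X n w)) n w.
Proof.
rewrite /unmet /=; split; apply: contra_not => H j jN; have := H j jN;
  rewrite big_ord_recr /draw /= eq_sym; case: eqP => _ /=;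
  by rewrite ?addn0 // addn1; case: (r j).
Qed.

Lemma measurable_preimage_draw k (B : set nat) : measurable (X k @^-1` B).
Proof. exact: measurable_funPTI. Qed.

Lemma measurable_unmet r n : measurable (unmet r n).
Proof.
elim: n r => [|n IH] r.
  rewrite /unmet.
  have [H|H] := pselect (forall j, (j < N)%N -> (r j <= 0)%N).
    rewrite (_ : [set _ | _] = set0) // -subset0 => w /=; apply => j jN.
    by rewrite big_ord0; exact: H.
  rewrite (_ : [set _ | _] = setT) // -subTset => w _ /=; apply: contra_not H => H j jN.
  by have := H j jN; rewrite big_ord0.
rewrite (_ : unmet r n.+1 = \bigcup_j (X n @^-1` [set j] `&` unmet (draw r j) n)).
  by apply: bigcup_measurable => j _; apply: measurableI => //; exact: measurable_preimage_draw.
apply/seteqP; split => [w /unmetS h|w [j _ [/= <- /unmetS]]] //.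
by exists (X n w).
Qed.

Hypothesis draws : coupon_draws N p X.
Hypothesis p_ge0 : forall j, (0 <= p j)%R.
Hypothesis sum_p : (\sum_(j < N) p j = 1)%R.

Let P_draw k j : (j < N)%N -> P (X k @^-1` [set j]) = (p j)%:E.
Proof. by have [_] := draws; exact. Qed.

(** The labels below [N] have total probability 1, so the remaining outcomes of [X n] form a null
    set. *)
Lemma measure_split_draw n (A : set Omega) : measurable A ->
  P A = \sum_(j < N) P (A `&` X n @^-1` [set (j : nat)]).
Proof.
move=> mA; pose F j := X n @^-1` [set j].
have mF j : measurable (F j) by exact: measurable_preimage_draw.
have tF : trivIset setT F.
  by move=> i j _ _ [w [/= <- <-]].
pose U := \big[setU/set0]_(j < N) F j.
have mU : measurable U by apply: bigsetU_measurable.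
have PU : P U = 1.
  rewrite /U measure_bigsetU //.
  by rewrite (eq_bigr (fun j : 'I_N => (p j)%:E)) ?sumEFin ?sum_p // => j _; exact: P_draw.
have PCU : P (~` U) = 0 by rewrite probability_setC // PU subee.
transitivity (P (A `&` U)).
  rewrite -[in LHS](setIT A) -(setUv U) setIUr measureU.
  - rewrite [X in _ + X](_ : _ = 0) ?adde0 //; apply/eqP.
    rewrite eq_le measure_ge0 andbT -PCU le_measure ?inE //.
    + by apply: measurableI => //; exact: measurableC.
    + exact: measurableC.
  - exact: measurableI.
  - by apply: measurableI => //; exact: measurableC.
  - by rewrite setIACA setICr setI0.
rewrite -(measure_bigsetU P (F := fun j => A `&` F j)) .
- by congr (P _); rewrite /U big_distrr.
- by move=> i; apply: measurableI.
- by move=> i j _ _ [w [[_ /= <-] [_ /= <-]]].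
Qed.

(** Arbitrary constraints on draws of index at least [n] make the induction work: splitting on the
    value of [X n] adds one more constraint of this kind. Mutual independence is invoked once, at
    [n = 0]. *)
Lemma prob_unmet_draws n r (s : seq nat) (B : nat -> set nat) :
  uniq s -> {in s, forall k, (n <= k)%N} ->
  P (unmet r n `&` \big[setI/setT]_(k <- s) (X k @^-1` B k)) =
  (pending N p n r)%:E * \prod_(k <- s) P (X k @^-1` B k).
Proof.
have mC (s' : seq nat) (B' : nat -> set nat) :
    measurable (\big[setI/setT]_(k <- s') (X k @^-1` B' k)).
  by apply: bigsetI_measurable => k _; exact: measurable_preimage_draw.
elim: n r s B => [|n IH] r s B us ns.
  have [ind _] := draws; rewrite -ind //=.
  case: (boolP [forall j : 'I_N, r j == 0%N]) => H.
    rewrite mul0e (_ : unmet r 0 = set0) ?set0I ?measure0 //.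
    rewrite -subset0 => w; apply => j jN.
    by have /forallP/(_ (Ordinal jN))/eqP/= -> := H.
  rewrite mul1e (_ : unmet r 0 = setT) ?setTI //.
  rewrite -subTset => w _; move/forallP: H; apply: contra_not => H j.
  by have := H j (ltn_ord j); rewrite big_ord0 leqn0.
rewrite (@measure_split_draw n); last by apply: measurableI => //; exact: measurable_unmet.
have nns : n \notin s by apply/negP => /ns; rewrite ltnn.
transitivity (\sum_(j < N) (p j * pending N p n (draw r j))%:E *
    \prod_(k <- s) P (X k @^-1` B k)).
  apply: eq_bigr => j _.
  pose B' k := if k == n then [set (j : nat)] else B k.
  have B'E (T : Type) (op : T -> T -> T) (idx : T) (F : nat -> set nat -> T) :
      \big[op/idx]_(k <- n :: s) F k (B' k) = op (F n [set (j : nat)]) (\big[op/idx]_(k <- s) F k (B k)).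
    rewrite big_cons /B' eqxx; congr (op _ _); rewrite !big_seq.
    by apply: eq_bigr => k ks; case: eqP => // kn; move: nns; rewrite -kn ks.
  have -> : unmet r n.+1 `&` \big[setI/setT]_(k <- s) (X k @^-1` B k) `&` X n @^-1` [set (j : nat)] =
      unmet (draw r j) n `&` \big[setI/setT]_(k <- n :: s) (X k @^-1` B' k).
    rewrite (B'E _ setI setT (fun k b => X k @^-1` b)).
    apply/seteqP; split => [w [[/unmetS h1 h2] /= h3]|w [h1 [/= h3 h2]]].
      by split; [rewrite -h3|split].
    by split => //; split => //; apply/unmetS; rewrite h3.
  rewrite IH; first last.
  - by move=> k; rewrite inE => /predU1P[->|/ns /ltnW].
  - by rewrite /= nns us.
  rewrite (B'E _ *%E 1 (fun k b => P (X k @^-1` b))) muleA; congr (_ * _).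
  by rewrite P_draw // -EFinM mulrC.
rewrite -ge0_sume_distrl; first by rewrite sumEFin.
by move=> j _; rewrite lee_fin mulr_ge0 ?pending_ge0.
Qed.

Lemma prob_unmet n r : P (unmet r n) = (pending N p n r)%:E.
Proof.
have := @prob_unmet_draws n r [::] (fun=> setT) isT (fun=> ltac:(by [])).
by rewrite !big_nil setIT mule1.
Qed.

Variable m : nat.
Local Notation T := (collect_time N m X).
Local Notation U := (unmet (fun=> m)).

Let first_met w n0 := ~ U n0 w /\ forall n, (n < n0)%N -> U n w.

Let unmet_nincr n n' w : (n <= n')%N -> U n' w -> U n w.
Proof.
move=> nn'; apply: contra_not => H j jN; apply: leq_trans (H j jN) _.
rewrite -!(big_mkord xpredT (fun k => nat_of_bool (X k w == j))).
by rewrite [leqRHS](big_cat_nat (leq0n n) nn') leq_addr.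
Qed.

Let first_metP w : (exists n0, first_met w n0) \/ forall n, U n w.
Proof.
have [[n Un]|H] := pselect (exists n, ~ U n w); last first.
  by right => n; apply: contrapT => Un; apply: H; exists n.
left; have H : exists n, `[< ~ U n w >] by exists n; exact/asboolP.
exists (ex_minn H); case: ex_minnP => n0 /asboolP Un0 min; split => // k kn0.
by apply: contrapT => /asboolP /min; rewrite leqNgt kn0.
Qed.

Lemma collect_time_first w n0 : first_met w n0 -> T w = n0%:R%R.
Proof.
move=> [Un0 U_lt]; rewrite /collect_time.
rewrite (_ : ereal_inf _ = n0%:R%:E) //; apply/eqP; rewrite eq_le; apply/andP; split.
  by apply: ereal_inf_lbound; exists n0 => //; apply: contrapT.
apply/ereal_infP => _ [n Hn <-]; rewrite lee_fin ler_nat leqNgt; apply/negP => /U_lt.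
exact.
Qed.

Lemma collect_time_never w : (forall n, U n w) -> T w = 0%R.
Proof.
move=> H; rewrite /collect_time (_ : [set n | _] = set0) ?image_set0 ?ereal_inf0 //.
by rewrite -subset0 => n /= Hn; exact: (H n).
Qed.

(** The event [U n] occurs exactly for n < n0, so the series reduces to its first n0 terms. *)
Let series_first (c : nat -> R) w n0 : (forall n, (0 <= c n)%R) -> first_met w n0 ->
  \sum_(0 <= n <oo) (c n * \1_(U n) w)%:E = (\sum_(k < n0) c k)%:E.
Proof.
move=> c0 [Un0 U_lt]; rewrite (nneseries_split 0 n0); last first.
  by move=> k _; rewrite lee_fin mulr_ge0.
rewrite add0n eseries0 ?adde0; last first.
  move=> n nn0 _; rewrite indicE memNset ?mulr0 //.
  by apply: contra_not Un0; exact: unmet_nincr.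
rewrite big_mkord -sumEFin; apply: eq_bigr => k _.
by rewrite indicE mem_set ?mulr1 //; exact: U_lt.
Qed.

Let series_never w : (forall n, U n w) ->
  \sum_(0 <= n <oo) (1 * \1_(U n) w)%:E = +oo :> \bar R.
Proof.
move=> H; apply/eqyP => A A0; have [n An] : exists n : nat, (A <= n%:R)%R.
  by exists (Num.bound A); rewrite ltW // archi_boundP // ltW.
apply: (@le_trans _ _ (\sum_(0 <= k < n) (1 * \1_(U k) w)%:E)); last first.
  by apply: nneseries_lim_ge => k _ _; rewrite lee_fin mulr_ge0.
rewrite (eq_bigr (fun=> 1%:E)); last by move=> k _; rewrite indicE mem_set ?mulr1.
by rewrite sumEFin lee_fin sumr_const_nat subn0.
Qed.

Lemma measurable_series_unmet (c : nat -> R) : (forall n, (0 <= c n)%R) ->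
  measurable_fun setT (fun w => \sum_(0 <= n <oo) (c n * \1_(U n) w)%:E).
Proof.
move=> c0; apply: ge0_emeasurable_sum => [k w _ _|k _]; first by rewrite lee_fin mulr_ge0.
apply/measurable_EFinP; apply: measurable_funM => //.
by apply: measurable_indic; exact: measurable_unmet.
Qed.

(** [T] is [fine] of the number of n at which the collection is incomplete. If it is never completed
    this number is +oo, which [fine] sends to 0, as in [collect_time]. *)
Lemma measurable_collect_time : measurable_fun setT T.
Proof.
rewrite (_ : T = fine \o (fun w => \sum_(0 <= n <oo) (1 * \1_(U n) w)%:E)).
  apply: measurableT_comp => //.
  exact: (measurable_series_unmet (fun=> ler01)).
apply/funext => w /=; have [[n0 fn0]|H] := first_metP w.
  by rewrite (collect_time_first fn0) (series_first (fun=> ler01) fn0) /= sumr_const card_ord.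
by rewrite (collect_time_never H) series_never.
Qed.

Lemma collect_time_ge0 w : (0 <= T w)%R.
Proof.
have [[n0 /collect_time_first ->]|/collect_time_never ->//] := first_metP w.
exact: ler0n.
Qed.

Hypothesis pending_fin : \sum_(0 <= n <oo) (pending N p n (fun=> m))%:E < +oo.

(** Summation by parts: f(T) is the sum of the c_n over n < T, that is, of c_n 1_(U n) over all n,
    almost surely. The expectation is then taken term by term. *)
Lemma integral_collect_time (c f : nat -> R) : (forall n, (0 <= c n)%R) ->
  (forall n, (f n = \sum_(k < n) c k)%R) -> forall g : Omega -> R,
  measurable_fun setT g -> (forall w, (0 <= g w)%R) ->
  (forall w n, T w = n%:R%R -> g w = f n) ->
  \int[P]_w (g w)%:E = \sum_(0 <= n <oo) (c n * pending N p n (fun=> m))%:E.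
Proof.
move=> c0 fE g mg g0 gE.
transitivity (\int[P]_w \sum_(0 <= n <oo) (c n * \1_(U n) w)%:E).
  apply: ge0_ae_eq_integral => //.
  - exact/measurable_EFinP.
  - exact: measurable_series_unmet.
  - by move=> w _; rewrite lee_fin.
  - by move=> w _; apply: nneseries_ge0 => n _ _; rewrite lee_fin mulr_ge0.
  (* The identity can fail only if the collection is never completed, a case contained in the limit
     superior of the [U n], which is null by Borel-Cantelli. *)
  exists (lim_sup_set U); split.
  - by apply: bigcap_measurable => // k _; apply: bigcup_measurable => j _; exact: measurable_unmet.
  - apply: lim_sup_set_cvg0 => [k|]; first exact: measurable_unmet.
    by rewrite (eq_eseriesr (fun n _ => prob_unmet n (fun=> m))).
  move=> w /= H n _; exists n => /=; first by [].
  have [[n0 fn0]|//] := first_metP w.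
  exfalso; apply: H => _.
  by rewrite (gE _ _ (collect_time_first fn0)) fE (series_first c0 fn0).
rewrite integral_nneseries //.
- apply: eq_eseriesr => n _; under eq_integral do rewrite EFinM.
  rewrite ge0_integralZl_EFin //.
  + rewrite integral_indic //; last exact: measurable_unmet.
    by rewrite setIT EFinM; congr (_ * _); exact: prob_unmet.
  + by apply/measurable_EFinP/measurable_indic; exact: measurable_unmet.
- move=> n; apply/measurable_EFinP; apply: measurable_funM => //.
  by apply: measurable_indic; exact: measurable_unmet.
- by move=> n w _; rewrite lee_fin mulr_ge0.
Qed.

Lemma expectation_collect_time :
  'E_P[T] = \sum_(0 <= n <oo) (pending N p n (fun=> m))%:E.
Proof.
rewrite unlock (@integral_collect_time (fun=> 1%R) (fun n => n%:R)%R) //.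
- by apply: eq_eseriesr => n _; rewrite mul1r.
- by move=> n; rewrite sumr_const card_ord.
- exact: measurable_collect_time.
- exact: collect_time_ge0.
Qed.

Lemma expectation_collect_time2 :
  'E_P[(fun w => T w * (T w + 1))%R] =
  \sum_(0 <= n <oo) (2 * n.+1%:R * pending N p n (fun=> m))%:E.
Proof.
rewrite unlock.
(* The increments of n(n + 1) are 2(n + 1). *)
rewrite (@integral_collect_time (fun n => 2 * n.+1%:R)%R (fun n => n%:R * (n%:R + 1))%R) //.
- elim=> [|n IH]; first by rewrite big_ord0 mul0r.
  by rewrite big_ord_recr /= -IH -natr1; ring.
- have mT := measurable_collect_time.
  by apply: measurable_funM => //; exact: measurable_funD.
- by move=> w; rewrite mulr_ge0 ?addr_ge0 ?collect_time_ge0.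
- by move=> w n ->.
Qed.

Hypothesis pending2_fin :
  \sum_(0 <= n <oo) (2 * n.+1%:R * pending N p n (fun=> m))%:E < +oo.

(** T^2 <= T(T + 1), whose expectation is the series assumed finite. *)
Lemma Lfun2_collect_time : T \in Lfun P 2%:E.
Proof.
have mT := measurable_collect_time.
rewrite inE; apply/andP; split; rewrite inE //=.
rewrite /finite_norm; apply: (@lty_poweRy _ _ 2) => //.
rewrite poweR_Lnorm //; apply: le_lt_trans pending2_fin.
have E w : `|(T w)%:E| `^ 2 = (T w ^+ 2)%:E.
  by rewrite /= ger0_norm ?collect_time_ge0 // powR_mulrn // collect_time_ge0.
rewrite -expectation_collect_time2 unlock; under eq_integral do rewrite E.
apply: ge0_le_integral => //.
- by move=> w _; rewrite lee_fin sqr_ge0.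
- by apply/measurable_EFinP; exact: measurable_funX.
- by apply/measurable_EFinP; apply: measurable_funM => //; exact: measurable_funD.
- by move=> w _; rewrite lee_fin mulrDr mulr1 lerDl collect_time_ge0.
Qed.

(** E[T^2] is obtained as E[T(T + 1)] - E[T], all terms being finite. *)
Lemma variance_collect_time : 'V_P[T] =
  \sum_(0 <= n <oo) (2 * n.+1%:R * pending N p n (fun=> m))%:E -
  \sum_(0 <= n <oo) (pending N p n (fun=> m))%:E -
  (\sum_(0 <= n <oo) (pending N p n (fun=> m))%:E) ^+ 2.
Proof.
have T2 := Lfun2_collect_time.
have T1 : T \in Lfun P 1 by apply: Lfun_subset12 T2; rewrite fin_num_measure.
rewrite varianceE // -expectation_collect_time -expectation_collect_time2; congr (_ - _).
rewrite (_ : (fun w => T w * (T w + 1))%R = (T ^+ 2 \+ T)%R); last first.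
  by apply/funext => w /=; rewrite fctE mulrDr mulr1.
rewrite expectationD //; last exact: Lfun2_mul_Lfun1.
by rewrite addeK // expectation_fin_num.
Qed.

End unmet_probability.

(** * Moments of the collection time in terms of [E_m] and [Q_m] *)

Section draws_moments.
Context (R : realType) (a : nat -> R) (m N : nat) (d : measure_display)
  (Omega : measurableType d) (P : probability Omega R)
  (X : nat -> {RV P >-> nat}).
Hypothesis a_gt0 : forall j, (0 < a j)%R.
Hypothesis N_gt0 : (0 < N)%N.
Hypothesis draws : coupon_draws N (fun j => a j / partial_weight a N)%R X.
Hypothesis E_fin : E_m m a N \is a fin_num.
Hypothesis Q_fin : Q_m m a N \is a fin_num.
Local Notation T := (collect_time N m X).
Local Notation A := (partial_weight a N).

Let A_gt0 : (0 < A)%R. Proof. exact: partial_weight_gt0. Qed.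

Let p_ge0 j : (0 <= a j / A)%R.
Proof. by rewrite divr_ge0 // ltW. Qed.

Let sum_p : (\sum_(j < N) a j / A = 1)%R.
Proof. by rewrite -mulr_suml divff // gt_eqF. Qed.

Let pending_fin : \sum_(0 <= n <oo)
  (pending N (fun j => a j / A)%R n (fun=> m))%:E < +oo.
Proof. by rewrite -E_m_series // -(fineK E_fin) -EFinM ltry. Qed.

Let pending2_fin : \sum_(0 <= n <oo)
  (2 * n.+1%:R * pending N (fun j => a j / A)%R n (fun=> m))%:E < +oo.
Proof. by rewrite -Q_m_series // -(fineK Q_fin) -EFinM ltry. Qed.

Lemma expectation_E_m : 'E_P[T] = A%:E * E_m m a N.
Proof. by rewrite (expectation_collect_time draws) // E_m_series. Qed.

Lemma expectation_Q_m : 'E_P[(fun w => T w * (T w + 1))%R] = (A ^+ 2)%:E * Q_m m a N.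
Proof. by rewrite (expectation_collect_time2 draws) // Q_m_series. Qed.

Lemma variance_Q_m : 'V_P[T] =
  (A ^+ 2)%:E * Q_m m a N - A%:E * E_m m a N - (A%:E * E_m m a N) ^+ 2.
Proof. by rewrite (variance_collect_time draws) // -E_m_series // -Q_m_series. Qed.

End draws_moments.

(** * Asymptotics of the moments and of the variance *)

Theorem theorem2p2 (R : realType) (a : nat -> R) (m : nat)
    (d : nat -> measure_display) (Omega : forall N, measurableType (d N))
    (P : forall N, probability (Omega N) R)
    (X : forall N, nat -> {RV (P N) >-> nat})
    (a_gt0 : forall j, (0 < a j)%R) (m_gt0 : (0 < m)%N)
    (L1_fin : L1 m a < +oo)
    (draws : forall N, (0 < N)%N ->
      coupon_draws N (fun j => a j / partial_weight a N)%R (X N)) :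
  let A := partial_weight a in
  let T := fun N => collect_time N m (X N) in
  let delta := fun N => L1 m a - E_m m a N in
  let Delta := fun N => L2 m a - Q_m m a N in
  let ET := fun N => 'E_(P N)[T N] in
  let ETT := fun N => 'E_(P N)[(fun w => T N w * (T N w + 1))%R] in
  let VT := fun N => 'V_(P N)[T N] in
  [/\ delta @ \oo --> 0 /\ Delta @ \oo --> 0,
      (forall N, (0 < N)%N -> ET N = (A N)%:E * (L1 m a - delta N)) /\
      eq_mul_1o ET (fun N => (A N)%:E * L1 m a),
      (forall N, (0 < N)%N -> ETT N = (A N ^+ 2)%:E * (L2 m a - Delta N)) /\
      eq_mul_1o ETT (fun N => (A N ^+ 2)%:E * L2 m a),
      eq_mul_1o VT (fun N => (A N ^+ 2)%:E * (L2 m a - L1 m a ^+ 2)) &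
      0 < L2 m a - L1 m a ^+ 2].
Proof.
move=> A T delta Delta ET ETT VT.
have E_fin N := fin_num_E_m a_gt0 L1_fin N.
have Q_fin N := fin_num_Q_m a_gt0 m_gt0 L1_fin N.
pose e N := fine (E_m m a N); pose q N := fine (Q_m m a N).
pose l1 := fine (L1 m a); pose l2 := fine (L2 m a).
have eE N : E_m m a N = (e N)%:E by rewrite fineK.
have qE N : Q_m m a N = (q N)%:E by rewrite fineK.
have l1E : L1 m a = l1%:E by rewrite fineK // fin_num_L1.
have l2E : L2 m a = l2%:E by rewrite fineK // (fin_num_L2 a_gt0 m_gt0 L1_fin).
have ce : e @ \oo --> l1.
  by apply: fine_cvg; rewrite -l1E; exact: E_m_cvg.
have cq : q @ \oo --> l2.
  by apply: fine_cvg; rewrite -l2E; exact: Q_m_cvg.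
have A_gt0 N : (0 < N)%N -> (0 < A N)%R by exact: partial_weight_gt0.
have [eps eps0 Heps] := Q_m_gap a_gt0 m_gt0 L1_fin.
have l1_gt0 : (0 < l1)%R.
  rewrite -lte_fin -l1E; apply: lt_le_trans (E_m_le_L1 _ a_gt0 1).
  by rewrite eE lte_fin; exact: fine_E_m_gt0.
(* The gap [eps] does not depend on N, so the inequality remains strict in the limit; indices are
   shifted because [Q_m_gap] needs at least one type. *)
have var_gt0 : (0 < l2 - l1 ^+ 2)%R.
  apply: (@lt_le_trans _ _ eps) => //; rewrite lerBrDl.
  have c2 : (fun N => e N.+1 ^+ 2 + eps)%R @ \oo --> (l1 ^+ 2 + eps)%R.
    apply: cvgD; last exact: cvg_cst.
    by rewrite expr2; under eq_fun do rewrite expr2; apply: cvgM; rewrite (cvg_shiftS e).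
  have c3 : (fun N => q N.+1) @ \oo --> l2 by rewrite (cvg_shiftS q).
  rewrite -(cvg_lim _ c2) // -(cvg_lim _ c3) //; apply: ler_lim.
  - exact: cvgP c2.
  - exact: cvgP c3.
  - exact: nearW.
have l2_gt0 : (0 < l2)%R by have := sqr_ge0 l1; lra.
have ETE N : (0 < N)%N -> ET N = (A N * e N)%:E.
  by move=> N0; rewrite EFinM -eE; apply: expectation_E_m => //; exact: draws.
have ETTE N : (0 < N)%N -> ETT N = (A N ^+ 2 * q N)%:E.
  by move=> N0; rewrite EFinM -qE; apply: expectation_Q_m => //; exact: draws.
have VTE N : (0 < N)%N -> VT N = (A N ^+ 2 * q N - A N * e N - (A N * e N) ^+ 2)%:E.
  move=> N0; rewrite /VT (variance_Q_m a_gt0 N0 (draws N N0)) // qE eE.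
  by rewrite -!EFinM expe2 -EFinM -!EFinB expr2.
(* E[T] / A_N^2 = e_N / A_N is the part of the normalised variance that vanishes because A_N tends
   to infinity. *)
have cA : (fun N => e N / A N)%R @ \oo --> (0 : R)%R.
  rewrite -(mulr0 l1); apply: cvgM => //.
  apply/(@gtr0_cvgV0 _ _ _ _ A); last exact: partial_weight_cvgy m_gt0 L1_fin.
  by exists 1%N => // N /= N0; exact: A_gt0.
split.
- split; rewrite /delta /Delta.
    rewrite l1E; under eq_fun do rewrite eE -EFinB.
    by apply: cvg_EFin; [exact: nearW|rewrite -(subrr l1); apply: cvgB => //; exact: cvg_cst].
  rewrite l2E; under eq_fun do rewrite qE -EFinB.
  by apply: cvg_EFin; [exact: nearW|rewrite -(subrr l2); apply: cvgB => //; exact: cvg_cst].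
- split.
    move=> N N0; rewrite ETE // /delta l1E eE -!EFinB -EFinM; congr (_ %:E); ring.
  exists (fun N => e N / l1 - 1)%R; split.
    rewrite -(subrr (1 : R)%R); apply: cvgB; last exact: cvg_cst.
    by rewrite -(divff (lt0r_neq0 l1_gt0)); apply: cvgM => //; exact: cvg_cst.
  exists 1%N => // N /= N0; rewrite ETE // l1E -!EFinM; congr (_ %:E).
  by field; rewrite gt_eqF.
- split.
    move=> N N0; rewrite ETTE // /Delta l2E qE -!EFinB -EFinM; congr (_ %:E); ring.
  exists (fun N => q N / l2 - 1)%R; split.
    rewrite -(subrr (1 : R)%R); apply: cvgB; last exact: cvg_cst.
    by rewrite -(divff (lt0r_neq0 l2_gt0)); apply: cvgM => //; exact: cvg_cst.
  exists 1%N => // N /= N0; rewrite ETTE // l2E -!EFinM; congr (_ %:E).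
  by field; rewrite gt_eqF.
(* V[T] / A_N^2 = q_N - e_N / A_N - e_N^2, compared with its limit, which is nonzero by
   [var_gt0]. *)
- exists (fun N => (q N - e N / A N - e N ^+ 2) / (l2 - l1 ^+ 2) - 1)%R; split.
    rewrite -(subrr (1 : R)%R); apply: cvgB; last exact: cvg_cst.
    rewrite -(divff (lt0r_neq0 var_gt0)); apply: cvgM; last exact: cvg_cst.
    rewrite -[X in (X - _)%R](subr0 l2); apply: cvgB; first exact: cvgB.
    by rewrite expr2; under eq_fun do rewrite expr2; apply: cvgM.
  exists 1%N => // N /= N0; rewrite VTE // l1E l2E -!EFinM -expr2; congr (_ %:E).
  have := lt0r_neq0 (A_gt0 N N0); move: (lt0r_neq0 var_gt0).
  by move: (l2 - l1 ^+ 2)%R (A N) => v b v0 b0; field; apply/andP.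
- by rewrite l1E l2E expe2 -EFinM -EFinB lte_fin -expr2.
Qed.
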